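(* For each $\gamma > 0$ there are $c, n_0 > 0$ such that the following holds for every $n \geq n_0$. If $G=(A,B,E)$ is a balanced bipartite graph on $2n$ vertices with minimum degree $\delta(G) \geq (\frac12+\gamma)n$, and $T$ is a balanced rooted tree on $2(1-\gamma)n$ vertices with maximum degree $\Delta(T) \leq cn$, then $T$ embeds in $G$ with the root of $T$ embedded in $A$.
   Context: $G=(A,B,E)$ denotes a bipartite graph with parts $A$, $B$ and edge set $E$. A bipartite graph (in particular a tree) is balanced if its two bipartition classes have the same number of vertices. A graph $H$ embeds in $G$ if $G$ contains a copy of $H$ as a (not necessarily induced) subgraph, i.e. there is an injective map $V(H)\to V(G)$ sending edges of $H$ to edges of $G$. $\delta$ and $\Delta$ denote minimum and maximum degree. *)

(* Defs.v *)
From mathcomp Require Import all_boot all_order all_algebra.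
From mathcomp Require Import reals.

Set Implicit Arguments.
Unset Strict Implicit.
Unset Printing Implicit Defensive.

Record sgraph := SGraph {
  vertex :> finType;
  adj : rel vertex;
  adj_sym : symmetric adj;
  adj_irr : irreflexive adj
}.

Definition degree (G : sgraph) (v : G) : nat := #|[set w | adj v w]|.

(* Degrees are less than #|G|, so the default value of the minimum only matters
   for the graph without vertices, whose minimum degree is then 0. *)
Definition min_degree (G : sgraph) : nat := \big[minn/#|G|]_(v : G) degree v.

Definition max_degree (G : sgraph) : nat := \max_(v : G) degree v.

Definition bipartition (G : sgraph) (A B : {set G}) : Prop :=
  [/\ A :|: B = setT, A :&: B = set0 &
      forall x y : G, adj x y ->
        (x \in A /\ y \in B) \/ (x \in B /\ y \in A)].

Definition balanced_bipartition (G : sgraph) (A B : {set G}) : Prop :=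
  bipartition A B /\ #|A| = #|B|.

(* The bipartition of a tree is unique up to swapping the two classes, so for
   trees the choice of A and B is immaterial. *)
Definition balanced (G : sgraph) : Prop :=
  exists A B : {set G}, balanced_bipartition A B.

Definition connected (G : sgraph) : Prop :=
  0 < #|G| /\ forall x y : G, connect (@adj G) x y.

(* The bound on the size is needed because [:: x; y] is a ucycle for every edge
   xy, and the empty sequence is always one. *)
Definition acyclic (G : sgraph) : Prop :=
  forall s : seq G, 2 < size s -> ~ ucycle (@adj G) s.

Definition tree (G : sgraph) : Prop := connected G /\ acyclic G.

Definition embedding (H G : sgraph) (f : H -> G) : Prop :=
  injective f /\ forall x y : H, adj x y -> adj (f x) (f y).

(* Main.v *)
Require Import Defs.
From mathcomp Require Import all_boot all_order all_algebra.
From mathcomp Require Import reals.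
From mathcomp Require Import zify ring lra.
Set Implicit Arguments.
Unset Strict Implicit.
Unset Printing Implicit Defensive.
Import Order.TTheory GRing.Theory Num.Theory.
Local Open Scope ring_scope.

(** Cut the tree at boundedly many vertices (seeds) into small components, each
    hanging from a seed that is already embedded, and embed the components one
    by one.  For a set [U] of used vertices in one class let [disc U v] compare
    the number of neighbours of [v] in [U] with the number expected for a random
    set of size [#|U|].  As long as the sum of the squares of the discrepancies
    is small, all but few vertices keep more than half of the unused vertices of
    the opposite class as neighbours.  To first order, a new component changes
    this sum by a total of weights ([drift]) at the vertices it uses, and over
    the unused vertices these weights average to at most zero.  Since all
    relevant degrees exceed one half, LP duality for fractional matchings yields
    level sets of the weights which are joined by many edges and on which the
    total weight is at most about the average; inside them some subgraph has
    linear minimum degree, and there the component is embedded greedily.  The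
    second-order terms are harmless because the components are small.  The top
    vertex of a component goes to a small random-like reservoir fixed in advance,
    which connects every seed to the chosen subgraph; the degree bound on the
    tree ensures that there are few top vertices. *)

(** * Discrepancies *)

Definition nbh (G : sgraph) (v : G) : {set G} := [set w | adj v w].

Section Discrepancy.
Variables (R : realFieldType) (G : sgraph) (Q : {set G}).
Implicit Types (U S : {set G}) (u v : G).

Definition dens v : R := #|nbh v :&: Q|%:R / #|Q|%:R.

Definition disc U v : R := #|nbh v :&: U|%:R - dens v * #|U|%:R.

(* To first order, using [u] increases [energy U] by [2 * drift U u], see [energyU]. *)
Definition energy U : R := \sum_v disc U v ^+ 2.

Definition drift U u : R := \sum_v disc U v * ((adj v u)%:R - dens v).

(** Every used vertex contributes separately, so the discrepancy is additive in the set; the energy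
    of a disjoint union then expands like a square, with the drift as mixed term. *)
Lemma discE U v : disc U v = \sum_(u in U) ((adj v u)%:R - dens v).
Proof.
rewrite sumrB sumr_const -mulr_natr /disc; congr (_ - _).
rewrite -natr_sum -big_mkcondr sum1dep_card; congr (_%:R).
by apply: eq_card => u; rewrite !inE andbC.
Qed.

Lemma disc_setU U S v : [disjoint U & S] -> disc (U :|: S) v = disc U v + disc S v.
Proof.
move=> dUS; rewrite !discE (big_setID U) /= (setIidPr (subsetUl U S)).
suff /setDidPl dSU : [disjoint S & U] by rewrite setDUl setDv set0U dSU.
by rewrite disjoint_sym.
Qed.

Lemma disc_full v : disc Q v = 0.
Proof.
rewrite /disc /dens; have [/eqP|] := eqVneq #|Q| 0%N.
  by rewrite cards_eq0 => /eqP->; rewrite setI0 cards0 mulr0 subrr.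
by move=> Q0; rewrite divfK ?subrr // pnatr_eq0.
Qed.

Lemma sum_drift U S : \sum_(u in S) drift U u = \sum_v disc U v * disc S v.
Proof.
rewrite exchange_big /=; apply: eq_bigr => v _.
by rewrite [disc S v]discE mulr_sumr.
Qed.

Lemma sum_drift_unused U : U \subset Q ->
  \sum_(u in Q :\: U) drift U u = - energy U.
Proof.
move=> sUQ; have : \sum_(u in Q) drift U u = 0.
  by rewrite sum_drift big1 // => v _; rewrite disc_full mulr0.
rewrite (big_setID U) /= (setIidPr sUQ) sum_drift => /eqP.
rewrite addrC addr_eq0 => /eqP->; congr (- _).
Qed.

Lemma energyU U S : [disjoint U & S] ->
  energy (U :|: S) = energy U + 2 * \sum_(u in S) drift U u + energy S.
Proof.
move=> dUS; rewrite sum_drift mulr_sumr -!big_split /=.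
by apply: eq_bigr => v _; rewrite disc_setU //; ring.
Qed.

Lemma dens_ge0 v : 0 <= dens v.
Proof. by rewrite divr_ge0. Qed.

Lemma dens_le1 v : dens v <= 1.
Proof.
have [/eqP|Q0] := eqVneq #|Q| 0%N.
  by rewrite cards_eq0 /dens => /eqP->; rewrite cards0 invr0 mulr0.
rewrite ler_pdivrMr ?ltr0n ?lt0n // mul1r ler_nat.
by apply: subset_leq_card; apply: subsetIr.
Qed.

Lemma normr_adj_dens u v : `|(adj v u)%:R - dens v| <= 1.
Proof.
have := dens_ge0 v; have := dens_le1 v.
by case: adj => /= h1 h0; rewrite ler_norml; lra.
Qed.

Lemma energy_ge0 U : 0 <= energy U.
Proof. by apply: sumr_ge0 => v _; apply: sqr_ge0. Qed.

Lemma energy_le U : energy U <= #|G|%:R * #|U|%:R ^+ 2.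
Proof.
rewrite mulr_natl -sumr_const; apply: ler_sum => v _.
rewrite -[_ ^+ 2]real_normK ?num_real // lerXn2r ?nnegrE //.
rewrite discE (le_trans (ler_norm_sum _ _ _)) //.
by rewrite -sumr_const; apply: ler_sum => u _; apply: normr_adj_dens.
Qed.

(** The energy bounds a sum of squares, while the drift needs a sum of absolute values. The
    inequality [d <= (s m + d^2 / (s m)) / 2] replaces Cauchy-Schwarz and avoids square roots. *)
Lemma normr_drift_le (m s : R) U u : 0 < m -> 0 < s ->
  #|G|%:R <= 2 * m -> energy U <= s ^+ 2 * m ^+ 3 ->
  `|drift U u| <= 2 * s * m ^+ 2.
Proof.
move=> m0 s0 Gm eU.
have sm0 : 0 < s * m by rewrite mulr_gt0.
have h1 : `|drift U u| <= \sum_v (s * m + disc U v ^+ 2 / (s * m)) / 2.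
  rewrite (le_trans (ler_norm_sum _ _ _)) //; apply: ler_sum => v _.
  rewrite normrM (le_trans (ler_wpM2l _ (normr_adj_dens u v))) ?mulr1 //.
  rewrite -[disc U v ^+ 2]real_normK ?num_real //.
  set d := `|_|; rewrite -subr_ge0.
  have -> : (s * m + d ^+ 2 / (s * m)) / 2 - d = (s * m - d) ^+ 2 / (2 * (s * m)).
    by field; rewrite !gt_eqF.
  by rewrite divr_ge0 ?sqr_ge0 // mulr_ge0 // ltW.
apply: le_trans h1 _.
rewrite -mulr_suml big_split /= sumr_const -[_ *+ _]mulr_natl -mulr_suml -/(energy U).
have h2 : energy U / (s * m) <= s * m ^+ 2.
  by rewrite ler_pdivrMr //; apply: le_trans eU _; rewrite le_eqVlt; apply/orP; left; apply/eqP; ring.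
have h3 : #|G|%:R * (s * m) <= 2 * m * (s * m) by rewrite ler_wpM2r // ltW.
have -> : 2 * s * m ^+ 2 = (2 * m * (s * m) + 2 * (s * m ^+ 2)) / 2 by field.
have : 0 <= s * m ^+ 2 by rewrite mulr_ge0 ?sqr_ge0 // ltW.
by lra.
Qed.

(** Chebyshev's inequality, with the energy in the role of the variance. *)
Lemma card_disc_gt (t : R) U : 0 < t ->
  #|[set v | t < disc U v]|%:R * t ^+ 2 <= energy U.
Proof.
move=> t0; rewrite mulr_natl -sumr_const.
rewrite /energy [leRHS](bigID (mem [set v | t < disc U v])) /= -[X in X <= _]addr0.
apply: lerD; last by apply: sumr_ge0 => v _; apply: sqr_ge0.
apply: ler_sum => v; rewrite inE => tv.
by rewrite lerXn2r ?nnegrE ?ltW // (lt_trans t0).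
Qed.

Lemma card_disc_lt (t : R) U : 0 < t ->
  #|[set v | disc U v < - t]|%:R * t ^+ 2 <= energy U.
Proof.
move=> t0; rewrite mulr_natl -sumr_const.
rewrite /energy [leRHS](bigID (mem [set v | disc U v < - t])) /= -[X in X <= _]addr0.
apply: lerD; last by apply: sumr_ge0 => v _; apply: sqr_ge0.
apply: ler_sum => v; rewrite inE => tv.
have td : t < - disc U v by lra.
by rewrite -[leRHS]sqrrN lerXn2r ?nnegrE ?ltW // (lt_trans t0).
Qed.

Lemma low_energy_subset (k : nat) : (k <= #|Q|)%N ->
  exists U, [/\ U \subset Q, #|U| = k & energy U <= #|G|%:R * k%:R].
Proof.
elim: k => [|k IHk] kQ.
  exists set0; split; rewrite ?sub0set ?cards0 // mulr0 /energy big1 // => v _.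
  by rewrite discE big_set0 expr0n.
have [U [sUQ cU eU]] := IHk (ltnW kQ).
have [u uQU du] : exists2 u, u \in Q :\: U & drift U u <= 0.
  have [/exists_inP //|] := boolP [exists u in Q :\: U, drift U u <= 0].
  move=> /exists_inPn npos.
  have : 0 < \sum_(u in Q :\: U) drift U u.
    have : Q :\: U != set0 by rewrite -card_gt0 cardsD (setIidPr sUQ) cU subn_gt0.
    case/set0Pn=> u uQU; rewrite (bigD1 u) //=.
    have := npos u uQU; rewrite -ltNge => /ltr_pwDl; apply.
    apply: sumr_ge0 => w /andP[wQU _].
    by have := npos w wQU; rewrite -ltNge => /ltW.
  by rewrite sum_drift_unused // oppr_gt0 ltNge energy_ge0.
move: uQU; rewrite inE => /andP[uU uQ].
have dUu : [disjoint U & [set u]] by rewrite disjoint_sym disjoints1.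
exists (U :|: [set u]); split.
- by rewrite subUset sUQ sub1set.
- by rewrite setUC cardsU1 uU cU add1n.
rewrite energyU // big_set1 -[k.+1%:R]natr1 mulrDr mulr1.
have := energy_le [set u]; rewrite cards1 expr1n mulr1.
by lra.
Qed.

End Discrepancy.

(** * Level sets and dense subgraphs *)

Section Levels.
Variable R : realFieldType.

Lemma sum_levels_le (h c : R) (s : nat) : 0 < h -> 0 <= c ->
  h * \sum_(i < s) (i.+1%:R * h <= c)%R%:R <= c.
Proof.
move=> h0 c0; elim: s => [|s IHs]; first by rewrite big_ord0 mulr0.
rewrite big_ord_recr /=; case: (leP (s.+1%:R * h)) => [hc|_]; last by rewrite addr0.
apply: le_trans hc; rewrite mulrC (ler_wpM2r (ltW h0)) // -[s.+1%:R]natr1.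
rewrite lerD2r.
rewrite -[s in leRHS]card_ord -sumr_const; apply: ler_sum => i _.
by case: (i.+1%:R * h <= c).
Qed.

Lemma sum_card_levels_le (T : finType) (X : {set T}) (a : T -> R) (h : R) (s : nat) :
  0 < h -> (forall x, x \in X -> 0 <= a x) ->
  h * \sum_(i < s) #|[set x in X | (i.+1%:R * h <= a x)]|%:R <= \sum_(x in X) a x.
Proof.
move=> h0 a0.
have -> : \sum_(i < s) #|[set x in X | (i.+1%:R * h <= a x)]|%:R
    = \sum_(x in X) \sum_(i < s) (i.+1%:R * h <= a x)%R%:R :> R.
  rewrite exchange_big; apply: eq_bigr => i _.
  by rewrite -natr_sum -big_mkcondr sum1dep_card.
by rewrite mulr_sumr; apply: ler_sum => x /a0 ax; apply: sum_levels_le.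
Qed.

(* A layer-cake form of LP duality for fractional perfect matchings: the level
   sets found here are large enough to be joined by many edges. *)
Lemma large_level_sets (T1 T2 : finType) (X : {set T1}) (Y : {set T2})
    (a : T1 -> R) (b : T2 -> R) (h z : R) (s : nat) :
  0 < h -> (0 < s)%N -> X != set0 -> Y != set0 ->
  (forall x, x \in X -> 0 <= a x) -> (forall y, y \in Y -> 0 <= b y) ->
  (\sum_(x in X) a x) / #|X|%:R + (\sum_(y in Y) b y) / #|Y|%:R
    <= (1 - z) * (s%:R * h) ->
  exists2 i : nat, (i < s)%N &
    1 + z <= #|[set x in X | a x < i.+1%:R * h]|%:R / #|X|%:R
             + #|[set y in Y | b y < (s - i)%:R * h]|%:R / #|Y|%:R.
Proof.
move=> h0 s0 X0 Y0 a0 b0 hs.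
have cX : 0 < #|X|%:R :> R by rewrite ltr0n card_gt0.
have cY : 0 < #|Y|%:R :> R by rewrite ltr0n card_gt0.
pose F (i : 'I_s) : R := #|[set x in X | a x < i.+1%:R * h]|%:R / #|X|%:R
             + #|[set y in Y | b y < (s - i)%:R * h]|%:R / #|Y|%:R.
have [/existsP[i Fi]|] := boolP [exists i, 1 + z <= F i]; first by exists i.
move=> /existsPn Fz; exfalso.
have compl (T : finType) (V : {set T}) (f : T -> R) (t : R) : 0 < #|V|%:R :> R ->
    1 - #|[set x in V | f x < t]|%:R / #|V|%:R
    = #|[set x in V | t <= f x]|%:R / #|V|%:R :> R.
  move=> V0; apply: (mulIf (lt0r_neq0 V0)); rewrite mulrBl !divfK ?gt_eqF // mul1r.
  apply/eqP; rewrite subr_eq -natrD; apply/eqP; congr (_%:R).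
  rewrite -(cardsID [set x | f x < t] V) addnC; congr (_ + _)%N.
    by apply: eq_card => x; rewrite !inE leNgt andbC.
  by apply: eq_card => x; rewrite !inE.
(* If all level pairs fell short, the complementary fractions [2 - F i] would sum to more than
   [s (1 - z)], against the layer-cake bound [h2]. *)
have h1 : s%:R * (1 - z) < \sum_(i < s) (2 - F i).
  rewrite mulr_natl -[s in X in X < _]card_ord -sumr_const.
  apply: ltr_sum; first by apply/hasP; exists (Ordinal s0); rewrite // mem_index_enum.
  by move=> i _; have := Fz i; rewrite -ltNge; lra.
have h2 : h * \sum_(i < s) (2 - F i) <=
    (\sum_(x in X) a x) / #|X|%:R + (\sum_(y in Y) b y) / #|Y|%:R.
  have -> : \sum_(i < s) (2 - F i)
     = \sum_(i < s) #|[set x in X | i.+1%:R * h <= a x]|%:R / #|X|%:R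
       + \sum_(i < s) #|[set y in Y | i.+1%:R * h <= b y]|%:R / #|Y|%:R.
    (* The threshold for [b] falls as the one for [a] rises; reversing the index matches [s - i]
       with the increasing levels. *)
    rewrite [X in _ + X](reindex_inj rev_ord_inj) -big_split /=.
    apply: eq_bigr => i _; rewrite -!compl // /F.
    by rewrite subnSK //; lra.
  rewrite mulrDr -!mulr_suml !mulrA.
  by apply: lerD; rewrite ler_pM2r ?invr_gt0 //; apply: sum_card_levels_le.
have : h * (s%:R * (1 - z)) < h * \sum_(i < s) (2 - F i) by rewrite ltr_pM2l.
have -> : h * (s%:R * (1 - z)) = (1 - z) * (s%:R * h) by ring.
by move/lt_le_trans/(_ h2)/lt_le_trans/(_ hs); rewrite ltxx.
Qed.

End Levels.

Section DenseSubgraphs.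
Variables (R : realFieldType) (G : sgraph).
Implicit Types (X Y Z : {set G}).

Lemma sum_card_nbh X Y :
  (\sum_(x in X) #|nbh x :&: Y| = \sum_(y in Y) #|nbh y :&: X|)%N.
Proof.
have E V x : #|nbh x :&: V| = (\sum_(y in V) adj x y)%N.
  rewrite -big_mkcondr sum1dep_card.
  by apply: eq_card => u; rewrite !inE andbC.
under eq_bigr do rewrite E.
rewrite exchange_big; apply: eq_bigr => y _; rewrite E.
by apply: eq_bigr => x _; rewrite adj_sym.
Qed.

(** Vertices of degree below [d] are deleted one by one. Each deletion lowers the degree sum by less
    than [2 * d], so the strict inequality persists; it fails for the empty set. *)
Lemma min_degree_subset (d : R) Z :
  2 * d * #|Z|%:R < \sum_(v in Z) #|nbh v :&: Z|%:R ->
  exists Z', [/\ Z' \subset Z, Z' != set0 &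
    forall v, v \in Z' -> d <= #|nbh v :&: Z'|%:R].
Proof.
have [k] := ubnP #|Z|; elim: k Z => // k IHk Z; rewrite ltnS => Zk dZ.
have Z0 : Z != set0.
  by apply: contraTneq dZ => ->; rewrite cards0 mulr0 big_set0 ltxx.
have [/exists_inP[v vZ dv]|] := boolP [exists v in Z, #|nbh v :&: Z|%:R < d]; last first.
  by move=> /exists_inPn dZ'; exists Z; split=> // v /dZ'; rewrite -leNgt.
have cZ : #|Z| = #|Z :\ v|.+1 by rewrite (cardsD1 v) vZ.
have [||Z' [sZ' Z'0 dZ']] := IHk (Z :\ v).
- by rewrite -cZ.
- have E : \sum_(w in Z) #|nbh w :&: Z|%:R
      = \sum_(w in Z :\ v) #|nbh w :&: (Z :\ v)|%:R + 2 * #|nbh v :&: Z|%:R :> R.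
    rewrite (big_setD1 v) //= mulr2n mulrDl mul1r addrC addrA; congr (_ + _).
    have -> : #|nbh v :&: Z|%:R = \sum_(w in Z :\ v) (adj v w)%:R :> R.
      rewrite -natr_sum -big_mkcondr sum1dep_card; congr (_%:R).
      apply: eq_card => w; rewrite !inE andbC.
      by case: eqP => [->|//]; rewrite adj_irr andbF.
    rewrite -big_split; apply: eq_bigr => w _ /=.
    rewrite -natrD (cardsD1 v (nbh w :&: Z)) addnC; congr (_ + _)%:R.
      by apply: eq_card => u; rewrite !inE andbCA.
    by rewrite !inE vZ andbT adj_sym.
  by move: dZ; rewrite E cZ -natr1; lra.
exists Z'; split=> //; apply: subset_trans sZ' (subsetDl _ _).
Qed.

(** Both fractions are at most 1, so one of them is at least one half and the other at least [z]. A
    vertex with more than half of a class as neighbours keeps an [m]-fraction of that class inside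
    any half of it, so at least [z * m * #|X| * #|Y|] edges join [X1] and [Y1]. *)
Lemma min_degree_subset_bip (m z d : R) X Y X1 Y1 :
  0 <= m -> 0 <= z -> X != set0 -> Y != set0 -> [disjoint X & Y] ->
  (forall x, x \in X -> (2^-1 + m) * #|Y|%:R <= #|nbh x :&: Y|%:R) ->
  (forall y, y \in Y -> (2^-1 + m) * #|X|%:R <= #|nbh y :&: X|%:R) ->
  X1 \subset X -> Y1 \subset Y ->
  1 + z <= #|X1|%:R / #|X|%:R + #|Y1|%:R / #|Y|%:R ->
  0 <= d -> d * (#|X|%:R + #|Y|%:R) < z * m * (#|X|%:R * #|Y|%:R) ->
  exists Z, [/\ Z \subset X1 :|: Y1, Z != set0 &
    forall v, v \in Z -> d <= #|nbh v :&: Z|%:R].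
Proof.
move=> m0 z0 X0 Y0 dXY hX hY sX sY h1 d0 hd.
have cX : 0 < #|X|%:R :> R by rewrite ltr0n card_gt0.
have cY : 0 < #|Y|%:R :> R by rewrite ltr0n card_gt0.
have dX1Y1 : [disjoint X1 & Y1] by apply: disjointWl sX (disjointWr sY dXY).
have lX : #|X1|%:R <= #|X|%:R :> R by rewrite ler_nat subset_leq_card.
have lY : #|Y1|%:R <= #|Y|%:R :> R by rewrite ler_nat subset_leq_card.
have edges (V W W1 V1 : {set G}) : 0 < #|V|%:R :> R -> 0 < #|W|%:R :> R ->
    (forall x, x \in V -> (2^-1 + m) * #|W|%:R <= #|nbh x :&: W|%:R) ->
    V1 \subset V -> W1 \subset W ->
    2^-1 <= #|W1|%:R / #|W|%:R :> R -> z <= #|V1|%:R / #|V|%:R ->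
    z * m * (#|V|%:R * #|W|%:R) <= \sum_(x in V1) #|nbh x :&: W1|%:R.
  move=> cV cW hV sV sW; rewrite !ler_pdivlMr // => W1h V1z.
  apply: (@le_trans _ _ (\sum_(x in V1) m * #|W|%:R)).
    rewrite sumr_const -mulr_natr.
    have := ler_wpM2r (mulr_ge0 m0 (ltW cW)) V1z.
    by set p := _ * (_ * _); set q := _ * (_ * _) => pq; rewrite /p /q in pq *; lra.
  apply: ler_sum => x xV1; have := hV x (subsetP sV x xV1).
  have : #|nbh x :&: W|%:R <= #|nbh x :&: W1|%:R + (#|W|%:R - #|W1|%:R) :> R.
    rewrite -natrB ?subset_leq_card // -natrD ler_nat.
    have -> : (#|W| - #|W1| = #|W :\: W1|)%N by rewrite cardsD (setIidPr sW).
    rewrite -(cardsID W1 (nbh x :&: W)) leq_add // subset_leq_card //.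
      by rewrite -setIA setIS // subsetIr.
    by apply/subsetP => u; rewrite !inE => /andP[-> /andP[_ ->]].
  by lra.
have e1 : z * m * (#|X|%:R * #|Y|%:R) <= \sum_(x in X1) #|nbh x :&: Y1|%:R.
  have a1 : #|X1|%:R / #|X|%:R <= 1 :> R by rewrite ler_pdivrMr ?mul1r.
  have b1 : #|Y1|%:R / #|Y|%:R <= 1 :> R by rewrite ler_pdivrMr ?mul1r.
  have [hY1|hY1] := leP 2^-1 (#|Y1|%:R / #|Y|%:R :> R).
    by apply: edges => //; lra.
  rewrite -natr_sum sum_card_nbh natr_sum [#|X|%:R * _]mulrC.
  by apply: edges => //; lra.
have e2 : \sum_(y in Y1) #|nbh y :&: X1|%:R = \sum_(x in X1) #|nbh x :&: Y1|%:R :> R.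
  by rewrite -!natr_sum sum_card_nbh.
apply: min_degree_subset.
have -> : #|X1 :|: Y1| = (#|X1| + #|Y1|)%N.
  by rewrite cardsU (disjoint_setI0 dX1Y1) cards0 subn0.
have e3 : \sum_(x in X1) #|nbh x :&: Y1|%:R + \sum_(y in Y1) #|nbh y :&: X1|%:R
   <= \sum_(v in X1 :|: Y1) #|nbh v :&: (X1 :|: Y1)|%:R :> R.
  rewrite [leRHS](big_setID X1) /= (setIidPr (subsetUl X1 Y1)).
  have /setDidPl dYX : [disjoint Y1 & X1] by rewrite disjoint_sym.
  rewrite setDUl setDv set0U dYX.
  by apply: lerD; apply: ler_sum => v _; rewrite ler_nat subset_leq_card // setIS
    ?subsetUl ?subsetUr.
apply: lt_le_trans e3; rewrite e2 natrD.
have : d * (#|X1|%:R + #|Y1|%:R) <= d * (#|X|%:R + #|Y|%:R) by rewrite ler_wpM2l // lerD.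
by lra.
Qed.

(** Averaging over [Y] after double counting the edges between [X] and [Y]. *)
Lemma common_neighbor (d : R) X Y : Y != set0 ->
  (forall x, x \in X -> d * #|Y|%:R <= #|nbh x :&: Y|%:R) ->
  exists2 u, u \in Y & d * #|X|%:R <= #|nbh u :&: X|%:R.
Proof.
move=> /set0Pn[u0 u0Y] hX.
have [/exists_inP //|] := boolP [exists u in Y, d * #|X|%:R <= #|nbh u :&: X|%:R].
move=> /exists_inPn hu; exfalso.
have : \sum_(u in Y) #|nbh u :&: X|%:R < \sum_(u in Y) d * #|X|%:R.
  by apply: ltr_sum => [|u uY]; [apply/hasP; exists u0; rewrite ?mem_index_enum|
    rewrite ltNge hu].
rewrite -natr_sum sum_card_nbh natr_sum ltNge => /negP; apply.
rewrite sumr_const -[_ *+ #|Y|]mulr_natr mulrAC mulr_natr -sumr_const.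
exact: ler_sum.
Qed.

End DenseSubgraphs.

(** * Rooted trees *)

Section Distance.
Variables (T : sgraph) (r : T).
Hypothesis conT : connected T.

Let has_path (v : T) (n : nat) :=
  [exists p : n.-tuple T, path (@adj T) v p && (last v p == r)].

Lemma has_path_exists v : exists n, has_path v n.
Proof.
have /connectP[p vp rp] := conT.2 v r.
by exists (size p); apply/existsP; exists (in_tuple p); rewrite vp -rp /=.
Qed.

Definition dist_to v : nat := ex_minn (has_path_exists v).

Lemma dist_to_eq0 v : dist_to v = 0%N -> v = r.
Proof.
rewrite /dist_to; case: ex_minnP => n /existsP[p /andP[_ /eqP pr]] _ n0.
by subst n; rewrite (tuple0 p) in pr.
Qed.

Lemma dist_to_desc v : v != r -> exists2 u, adj v u & (dist_to u < dist_to v)%N.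
Proof.
move=> vr; rewrite {2}/dist_to; case: ex_minnP => -[|n] /existsP[p /andP[pv /eqP pr]] _.
  by move: pr vr; rewrite (tuple0 p) /= => ->; rewrite eqxx.
case/tupleP: p pv pr => u p /= /andP[vu pu] pr; exists u => //.
rewrite /dist_to; case: ex_minnP => m _; rewrite ltnS; apply.
by apply/existsP; exists p; rewrite pu pr /=.
Qed.

Definition parent v : T := odflt r [pick u | adj v u & (dist_to u < dist_to v)%N].

Lemma parent_root : parent r = r.
Proof.
rewrite /parent; case: pickP => //= u /andP[_].
have -> : dist_to r = 0%N; last by [].
rewrite /dist_to; case: ex_minnP => n _ nmin; apply/eqP; rewrite -leqn0; apply: nmin.
by apply/existsP; exists (@in_tuple T [::]); rewrite /=.
Qed.

Lemma parentP v : v != r -> adj v (parent v) && (dist_to (parent v) < dist_to v)%N.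
Proof.
move=> vr; rewrite /parent; case: pickP => [//|none].
by have [u vu du] := dist_to_desc vr; have := none u; rewrite vu du.
Qed.

(* Otherwise [y] and [parent x] could be joined both through [x] and through [r],
   which would give a cycle. *)
Lemma parent_adj_le x y : acyclic T -> adj x y -> (dist_to y <= dist_to x)%N ->
  x != r /\ parent x = y.
Proof.
move=> acT xy dyx.
have yx : y != x by apply: contraTneq xy => ->; rewrite adj_irr.
have xr : x != r.
  apply: contra_neq yx => xr; rewrite xr; apply: dist_to_eq0; apply/eqP.
  rewrite -leqn0 (leq_trans dyx) // xr /dist_to; case: ex_minnP => n _; apply.
  by apply/existsP; exists (@in_tuple T [::]); rewrite /=.
split=> //; apply/eqP; case: eqP => // /eqP pxy; exfalso.
(* [e] is the tree with [x] removed. *)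
pose e := [rel a b : T | [&& adj a b, a != x & b != x]].
have esym : symmetric e by move=> a b /=; rewrite adj_sym; congr (_ && _); rewrite andbC.
have ecsym : connect_sym e by apply: sym_connect_sym.
(* Distances fall along parents, so the walk to the root from a vertex no farther than [x] never
   meets [x]. *)
have to_r v : v != x -> (dist_to v <= dist_to x)%N -> connect e v r.
  have [k] := ubnP (dist_to v); elim: k v => // k IHk v; rewrite ltnS => vk vx dv.
  have [->|vr] := eqVneq v r; first exact: connect0.
  have /andP[vp dp] := parentP vr.
  have dpx := leq_trans dp dv.
  have px : parent v != x by apply: contraTneq dpx => ->; rewrite ltnn.
  apply: connect_trans (connect1 _) (IHk _ _ px (ltnW dpx)); first by rewrite /= vp vx px.
  exact: leq_trans dp vk.
have /andP[xp dp] := parentP xr.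
have px : parent x != x by apply: contraTneq dp => ->; rewrite ltnn.
have : connect e y (parent x).
  by apply: connect_trans (to_r _ yx dyx) _; rewrite ecsym to_r // ltnW.
(* A simple path from [y] to [parent x] avoiding [x] closes up through [x]. It has at least one edge
   since the ends differ, so the cycle has at least three vertices. *)
case/connectP=> p0 /shortenP[p yp up _] lp {p0}.
have p0 : p != [::] by apply: contraNneq pxy => p0; rewrite lp p0.
have xnp : x \notin p.
  elim: p y yp {xy dyx yx pxy up lp p0} => //= a p IHp y /andP[/and3P[_ _ ax] ap].
  by rewrite inE eq_sym negb_or ax (IHp a).
apply: (acT [:: x, y & p]); first by case: p p0 {yp up lp xnp}.
rewrite /ucycle /= xy rcons_path adj_sym -lp xp andbT inE negb_or xnp eq_sym yx /=.
move: up => /= ->; rewrite andbT.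
by apply: sub_path yp => a b /and3P[].
Qed.

End Distance.

(** The form in which the tree is used from here on: its edges are exactly those from a non-root
    vertex to its parent, and [dep] supports induction towards the root. *)
Lemma tree_parent (T : sgraph) (r : T) : tree T ->
  exists (par : T -> T) (dep : T -> nat),
    [/\ par r = r,
        forall v, v != r -> adj v (par v) && (dep (par v) < dep v)%N &
        forall x y, adj x y -> (x != r /\ par x = y) \/ (y != r /\ par y = x)].
Proof.
move=> [conT acT]; exists (parent r conT), (dist_to r conT).
split=> [|v|x y xy]; [exact: parent_root|exact: parentP|].
have [dyx|/ltnW dxy] := leqP (dist_to r conT y) (dist_to r conT x); [left|right].
  exact: parent_adj_le.
by apply: parent_adj_le; rewrite // adj_sym.
Qed.

(** * Cutting a tree at seeds and embedding one component *)

Section ParentMaps.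
Variables (T : finType) (r : T) (par : T -> T) (dep : T -> nat).
Hypothesis par_root : par r = r.
Hypothesis dep_par : forall v, v != r -> (dep (par v) < dep v)%N.
Implicit Types (W D C : {set T}) (v w y : T).

Lemma par_ind (P : T -> Prop) :
  (forall v, (v != r -> P (par v)) -> P v) -> forall v, P v.
Proof.
move=> step v; have [k] := ubnP (dep v); elim: k v => // k IHk v; rewrite ltnS => vk.
by apply: step => vr; apply: IHk; apply: leq_trans (dep_par vr) vk.
Qed.

Lemma fconnect_root v : fconnect par r v -> v = r.
Proof. by move/iter_findex <-; apply: iter_fix. Qed.

Lemma fconnect_dep w v : fconnect par w v -> w = v \/ (dep v < dep w)%N.
Proof.
elim/par_ind: w => w IHw; rewrite fconnect_eqVf; case/predU1P=> [|pwv]; first by left.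
have [wr|wr] := eqVneq w r.
  by left; move: pwv; rewrite wr par_root => /fconnect_root.
by right; case: (IHw wr pwv) => [<-|/ltn_trans]; [|apply]; apply: dep_par.
Qed.

Lemma fconnect_closed D w v :
  {in D, forall x, par x \in D} -> w \in D -> fconnect par w v -> v \in D.
Proof.
move=> clD wD /iter_findex <-; elim: (findex _ _ _) => //= n; exact: clD.
Qed.

(** Being a seed does not make a vertex a top: a seed belongs to the component entered from above,
    and its children start new ones. *)
Definition is_top W v := (v == r) || (par v \in W).

(* Deleting the edges from the vertices of [W] to their children splits the tree
   into components; [top W v] is the vertex nearest to the root in the component
   of [v]. *)
Definition top W v := iter (dep v) (fun u => if is_top W u then u else par u) v.

(** The recursion equation. [dep] drops at each move to the parent, so [dep v] iterations suffice,
    and further ones stay at the top already reached. *)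
Lemma topE W v : top W v = if is_top W v then v else top W (par v).
Proof.
set step := fun u => if is_top W u then u else par u.
have fix_top u n : is_top W u -> iter n step u = u.
  by move=> tu; apply: iter_fix; rewrite /step tu.
have dep0 u : dep u = 0%N -> is_top W u.
  move=> du; apply/orP; left; case: eqP => // /eqP /dep_par.
  by rewrite du.
have fuel n m u : (dep u <= n)%N -> (dep u <= m)%N -> iter n step u = iter m step u.
  elim: n m u => [|n IHn] [|m] u //.
  - by rewrite leqn0 => /eqP/dep0 tu _; rewrite !fix_top.
  - by rewrite [in X in _ -> X](leqn0) => _ /eqP/dep0 tu; rewrite !fix_top.
  have [tu|ntu] := boolP (is_top W u); first by rewrite !fix_top.
  have ur : u != r by case/norP: ntu.
  rewrite !iterSr /step (negbTE ntu) => un um.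
  by apply: IHn; rewrite -ltnS; apply: leq_trans (dep_par ur) _.
case: ifPn => [tv|ntv]; first by rewrite /top fix_top.
have vr : v != r by case/norP: ntv.
have dv : (0 < dep v)%N by apply: leq_ltn_trans (dep_par vr).
have -> : top W v = iter (dep v).-1 step (par v).
  by rewrite /top -/step -{1}(prednK dv) iterSr {2}/step (negbTE ntv).
by apply: fuel => //; rewrite -ltnS (prednK dv) dep_par.
Qed.

Lemma fconnect_top W v : fconnect par v (top W v).
Proof.
elim/par_ind: v => v IHv; rewrite topE; case: ifPn => [_|/norP[vr _]].
  exact: connect0.
exact: connect_trans (fconnect1 _ _) (IHv vr).
Qed.

(** A deepest vertex [v] with more than [s] descendants becomes a seed and its proper descendants,
    at least [s] of them, are removed; this pays for the seed. Strictly below [v] every vertex has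
    at most [s] descendants, so the new components are small. When no such [v] is left, the root
    alone is the last seed. *)
Lemma seeds_exist_in (s : nat) D : (0 < s)%N ->
  r \in D -> {in D, forall x, par x \in D} ->
  exists W, [/\ W \subset D, r \in W, (#|W|.-1 * s <= #|D|)%N &
    forall y, (#|[set w in D | top W w == y]| <= s)%N].
Proof.
move=> s0; have [k] := ubnP #|D|; elim: k D => // k IHk D; rewrite ltnS => Dk rD clD.
pose desc v := [set w in D | fconnect par w v].
have fib_desc W y : [set w in D | top W w == y] \subset desc y.
  by apply/subsetP => w; rewrite !inE => /andP[-> /eqP<-]; rewrite fconnect_top.
have [/exists_inP[v0 v0D hv0]|] := boolP [exists v in D, (s < #|desc v|)%N]; last first.
  move=> /exists_inPn small; exists [set r]; split=> [||//|y].
  - by rewrite sub1set.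
  - exact: set11.
  - by rewrite cards1.
  apply: leq_trans (subset_leq_card (fib_desc _ y)) _.
  have [yD|yD] := boolP (y \in D); first by rewrite leqNgt small.
  rewrite (_ : desc y = set0) ?cards0 //; apply/setP => w; rewrite !inE.
  by apply/negbTE; apply: contra yD => /andP[wD wy]; apply: fconnect_closed wy.
pose P v := (v \in D) && (s < #|desc v|)%N.
have Pv0 : P v0 by rewrite /P v0D.
case: (arg_maxnP dep Pv0) => v /andP[vD hv] vmax.
(* [v] itself is kept, since it belongs to the component above it. *)
pose D' := D :\: (desc v :\ v).
have D'E w : (w \in D') = (w \in D) && ((w == v) || ~~ fconnect par w v).
  by rewrite !inE; case: (w == v); case: (w \in D); rewrite ?andbT ?andbF //=.
have vdesc : v \in desc v by rewrite inE vD connect0.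
have cD : (#|D'| + #|desc v| = #|D|.+1)%N.
  have sd : desc v :\ v \subset D.
    by apply: subset_trans (subsetDl _ _) _; apply/subsetP => w; rewrite inE => /andP[].
  rewrite -(cardsID (desc v :\ v) D) (setIidPr sd) -/D' (cardsD1 v (desc v)) vdesc; lia.
have rD' : r \in D'.
  rewrite D'E rD; have [//|rv] := eqVneq r v.
  by apply/negP => /fconnect_root vr; rewrite vr eqxx in rv.
have clD' : {in D', forall x, par x \in D'}.
  move=> x; rewrite !D'E => /andP[xD xv]; rewrite clD //=.
  case/orP: xv => [/eqP->|xv].
    have [->|vr] := eqVneq v r; first by rewrite par_root eqxx.
    apply/orP; right; apply/negP => /fconnect_dep[pv|].
      by have := dep_par vr; rewrite {1}pv ltnn.
    by rewrite ltnNge ltnW // dep_par.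
  by apply/orP; right; apply: contra xv => /(connect_trans (fconnect1 _ _)).
have [||//|W' [sW' rW' cW' fW']] := IHk D'; first by lia.
- by [].
have sW'D : W' \subset D by apply: subset_trans sW' (subsetDl _ _).
exists (v |: W'); split.
- by rewrite subUset sub1set vD.
- by rewrite inE rW' orbT.
- have : (#|v |: W'|.-1 <= #|W'|.-1.+1)%N.
    have : (0 < #|W'|)%N by apply/card_gt0P; exists r.
    by rewrite cardsU1; case: (v \in W') => /=; lia.
  by rewrite -(leq_pmul2r s0) mulSn => h; apply: leq_trans h _; lia.
move=> y.
(* No child of [v] is left in [D'], so the new seed changes no top there. *)
have top_in w : w \in D' -> top (v |: W') w = top W' w.
  elim/par_ind: w => w IHw wD'; rewrite topE [RHS]topE.
  have -> : is_top (v |: W') w = is_top W' w.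
    rewrite /is_top in_setU1; have [//|wr] := eqVneq w r.
    have [pwv|//] := eqVneq (par w) v.
    move: wD'; rewrite D'E => /andP[_]; have [wv|_] := eqVneq w v.
      by have := dep_par wr; rewrite pwv wv ltnn.
    by rewrite -pwv fconnect1.
  by case: ifPn => // /norP[wr _]; rewrite IHw // clD'.
(* Climbing from a proper descendant of [v] stops at a child of [v] at the latest. *)
have top_out w : w \in D -> w \notin D' -> top (v |: W') w \notin D'.
  elim/par_ind: w => w IHw wD wD'; rewrite topE; case: ifPn => // /norP[wr].
  rewrite in_setU1 negb_or => /andP[pv _].
  apply: IHw => //; first exact: clD.
  move: wD'; rewrite !D'E wD (clD _ wD) /= (negbTE pv) !negbK.
  by rewrite fconnect_eqVf negb_or negbK => /andP[/negbTE->].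
have [yD'|yD'] := boolP (y \in D').
  apply: leq_trans (fW' y); apply: subset_leq_card; apply/subsetP => w
    /setIdP[wD /eqP wy].
  have wD' : w \in D' by apply: contraLR yD' => wD'; rewrite -wy top_out.
  by apply/setIdP; rewrite -top_in // wy eqxx; split.
apply: leq_trans (subset_leq_card (fib_desc _ y)) _.
have [yD|yD] := boolP (y \in D); last first.
  rewrite (_ : desc y = set0) ?cards0 //; apply/setP => w; rewrite !inE.
  by apply/negbTE; apply: contra yD => /andP[wD wy]; apply: fconnect_closed wy.
rewrite leqNgt; apply/negP => hy.
have := vmax y; rewrite /P yD hy => /(_ isT) dyv.
move: yD'; rewrite D'E yD /= negb_or negbK => /andP[yv /fconnect_dep[yv'|]].
  by rewrite yv' eqxx in yv.
by rewrite ltnNge (dyv : (dep y <= dep v)%N).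
Qed.

(** Induction removing a deepest vertex [w] other than [y], which is a leaf of [C]. The image of its
    parent has at least [k] neighbours in [Z], and the fewer than [k] vertices placed before cannot
    block all of them. *)
Lemma greedy_embedding (G : sgraph) (k : nat) (Z : {set G}) (u : G) C y :
  y \in C -> {in C, forall w, w != y -> (w != r) && (par w \in C)} ->
  (#|C| <= k)%N -> u \notin Z -> (k <= #|nbh u :&: Z|)%N ->
  {in Z, forall z, (k <= #|nbh z :&: Z|)%N} ->
  exists g : T -> G, [/\ g y = u, {in C &, injective g} &
    {in C, forall w, w != y -> g w \in Z /\ adj (g w) (g (par w))}].
Proof.
move=> yC clC Ck uZ uk Zk.
have [m] := ubnP #|C|; elim: m C yC clC Ck => // m IHm C yC clC Ck; rewrite ltnS => Cm.
have [/eqP C1|] := eqVneq (C :\ y) set0.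
  have Cy w : w \in C -> w = y.
    move=> wC; apply/eqP; apply: contraTT C1 => wy.
    by apply/set0Pn; exists w; rewrite !inE wy.
  exists (fun=> u); split=> // [w1 w2 /Cy-> /Cy-> //|w /Cy->].
  by rewrite eqxx.
case/set0Pn => w0 w0C.
case: (arg_maxnP dep w0C) => w /setD1P[wy wC] wmax.
have /andP[wr pwC] := clC w wC wy.
have pww : par w != w by apply: contraTneq (dep_par wr) => ->; rewrite ltnn.
have par_neq t : t \in C -> t != y -> par t != w.
  move=> tC ty; have /andP[tr _] := clC t tC ty.
  apply: contraTneq (dep_par tr) => ->; rewrite -leqNgt.
  by apply: wmax; have : t \in C :\ y by rewrite !inE ty.
have cC : #|C| = #|C :\ w|.+1 by rewrite (cardsD1 w) wC.
have [||||g [gy ginj gZ]] := IHm (C :\ w).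
- by rewrite !inE eq_sym wy.
- move=> t /setD1P[tw tC] ty; have /andP[-> ptC] := clC t tC ty.
  by rewrite !inE ptC par_neq.
- by lia.
- by lia.
have pwC' : par w \in C :\ w by rewrite !inE pww.
have kp : (k <= #|nbh (g (par w)) :&: Z|)%N.
  have [->|pwy] := eqVneq (par w) y; first by rewrite gy.
  by apply: Zk; case: (gZ _ pwC' pwy).
have [z] : exists z, z \in nbh (g (par w)) :&: Z :\: g @: (C :\ w).
  apply/set0Pn; rewrite -card_gt0 cardsD subn_gt0.
  apply: leq_ltn_trans (subset_leq_card (subsetIr _ _)) _.
  by apply: leq_ltn_trans (leq_imset_card _ _) _; lia.
rewrite !inE => /andP[zg /andP[pz zZ]].
pose g' t := if t == w then z else g t.
have g'E t : t != w -> g' t = g t by rewrite /g' => /negbTE->.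
have g'w : g' w = z by rewrite /g' eqxx.
have zgN t : t \in C -> t != w -> z != g t.
  by move=> tC tw; apply: contraNneq zg => ->; apply: imset_f; rewrite !inE tw.
exists g'; split.
- by rewrite g'E // eq_sym.
- move=> t1 t2 C1 C2; have [->|t1w] := eqVneq t1 w; have [->|t2w] := eqVneq t2 w => //.
  + by rewrite g'w g'E // => E; have := zgN _ C2 t2w; rewrite E eqxx.
  + by rewrite g'w g'E // => E; have := zgN _ C1 t1w; rewrite E eqxx.
  + by rewrite !g'E //; apply: ginj; rewrite !inE ?t1w ?t2w.
move=> t tC ty; rewrite [g' (par t)]g'E ?par_neq //.
have [->|tw] := eqVneq t w; first by rewrite g'w adj_sym.
by rewrite g'E //; apply: gZ; rewrite ?inE ?tw.
Qed.

End ParentMaps.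

(** * One embedding step in the host graph *)

Section OneSide.
Variables (R : realFieldType) (G : sgraph).
Implicit Types (g sg m : R) (Q U Bad : {set G}).

Lemma card_good g sg m Q U Bad :
  0 < g -> sg <= 1 -> 0 < m ->
  #|Bad|%:R <= sg * g / 256 * m -> g / 2 * m <= #|Q :\: U|%:R ->
  g / 4 * m <= #|Q :\: U :\: Bad|%:R.
Proof.
move=> g0 sg1 m0 cBad cQU; set X := Q :\: U :\: Bad.
have : #|Q :\: U|%:R <= #|X|%:R + #|Bad|%:R :> R.
  rewrite -natrD ler_nat -(cardsID Bad (Q :\: U)) addnC leq_add2l.
  by rewrite subset_leq_card ?subsetIr.
have : sg * (g * m) <= 1 * (g * m) by rewrite ler_wpM2r // mulr_ge0 // ltW.
have : 0 < g * m by rewrite mulr_gt0.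
by lra.
Qed.

Lemma mean_drift_good g sg m Q U Bad :
  0 < g -> 0 < sg -> sg <= 1 -> 0 < m -> #|G|%:R <= 2 * m -> U \subset Q ->
  energy R Q U <= sg ^+ 2 * m ^+ 3 ->
  #|Bad|%:R <= sg * g / 256 * m -> g / 2 * m <= #|Q :\: U|%:R ->
  (\sum_(u in Q :\: U :\: Bad) drift R Q U u) / #|Q :\: U :\: Bad|%:R
    <= sg ^+ 2 / 32 * m ^+ 2.
Proof.
move=> g0 sg0 sg1 m0 Gm sUQ eU cBad cQU.
have cX := card_good g0 sg1 m0 cBad cQU; set X := Q :\: U :\: Bad in cX *.
have X0 : 0 < #|X|%:R :> R by apply: lt_le_trans cX; rewrite !mulr_gt0 ?invr_gt0.
have h1 : \sum_(u in X) drift R Q U u <= #|Bad|%:R * (2 * sg * m ^+ 2).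
  have := sum_drift_unused R sUQ; rewrite (big_setID Bad) /= -/X => h.
  have h2 : - (#|Bad|%:R * (2 * sg * m ^+ 2)) <= \sum_(u in (Q :\: U) :&: Bad) drift R Q U u.
    have cI : #|(Q :\: U) :&: Bad|%:R <= #|Bad|%:R :> R.
      by rewrite ler_nat subset_leq_card ?subsetIr.
    have h3 : - (#|(Q :\: U) :&: Bad|%:R * (2 * sg * m ^+ 2))
         <= \sum_(u in (Q :\: U) :&: Bad) drift R Q U u.
      rewrite -mulrN [leLHS]mulr_natl -sumr_const; apply: ler_sum => u _.
      by have := normr_drift_le u m0 sg0 Gm eU; rewrite ler_norml => /andP[].
    apply: le_trans h3; rewrite lerN2 ler_wpM2r //.
    by rewrite mulr_ge0 ?sqr_ge0 // mulr_ge0 // ltW.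
  have := energy_ge0 R Q U; lra.
rewrite ler_pdivrMr //; apply: le_trans h1 _.
have p0 : 0 <= 2 * sg * m ^+ 2 by rewrite mulr_ge0 ?sqr_ge0 // mulr_ge0 // ltW.
have q0 : 0 <= sg ^+ 2 / 32 * m ^+ 2 by rewrite mulr_ge0 ?divr_ge0 ?sqr_ge0.
apply: le_trans (ler_wpM2r p0 cBad) _; apply: le_trans (ler_wpM2l q0 cX).
by rewrite le_eqVlt; apply/orP; left; apply/eqP; field.
Qed.

Lemma degree_good g sg m Q U Bad v :
  0 < g -> sg <= g -> 0 < m -> U \subset Q ->
  #|Bad|%:R <= sg * g / 256 * m -> g / 2 * m <= #|Q :\: U|%:R ->
  disc R Q U v <= g ^+ 2 / 32 * m -> 2^-1 + g / 2 <= dens R Q v ->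
  (2^-1 + g / 4) * #|Q :\: U :\: Bad|%:R <= #|nbh v :&: (Q :\: U :\: Bad)|%:R.
Proof.
move=> g0 sg1 m0 sUQ cBad cQU dv hv; set X := Q :\: U :\: Bad.
have Q0 : 0 < #|Q|%:R :> R.
  have : #|Q :\: U|%:R <= #|Q|%:R :> R by rewrite ler_nat subset_leq_card ?subsetDl.
  by move/(le_trans cQU); apply: lt_le_trans; rewrite mulr_gt0 // divr_gt0.
have h1 : #|nbh v :&: Q|%:R <= #|nbh v :&: U|%:R + (#|nbh v :&: X|%:R + #|Bad|%:R) :> R.
  rewrite -!natrD ler_nat -(cardsID U (nbh v :&: Q)) leq_add //.
    by rewrite subset_leq_card // setSI // subsetIl.
  rewrite -(cardsID Bad (_ :\: U)) addnC leq_add ?subset_leq_card ?subsetIr //.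
  by apply/subsetP => u; rewrite !inE => /andP[-> /andP[-> /andP[-> ->]]].
have h2 : #|nbh v :&: Q|%:R = dens R Q v * #|Q|%:R by rewrite /dens divfK // gt_eqF.
have h3 : #|Q|%:R = #|U|%:R + #|Q :\: U|%:R :> R.
  by rewrite -natrD -(cardsID U Q) (setIidPr sUQ).
have h4 : #|X|%:R <= #|Q :\: U|%:R :> R by rewrite ler_nat subset_leq_card ?subsetDl.
have h5 : (2^-1 + g / 2) * #|Q :\: U|%:R <= dens R Q v * #|Q :\: U|%:R.
  by rewrite ler_wpM2r.
have h6 : (2^-1 + g / 4) * #|X|%:R <= (2^-1 + g / 4) * #|Q :\: U|%:R.
  by rewrite ler_wpM2l //; lra.
have h7 : g / 4 * (g / 2 * m) <= g / 4 * #|Q :\: U|%:R.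
  by rewrite ler_wpM2l // divr_ge0 // ltW.
have h8 : sg * (g * m) <= g * (g * m) by rewrite ler_wpM2r // mulr_ge0 // ltW.
have h9 : 0 <= g ^+ 2 * m by rewrite mulr_ge0 ?sqr_ge0 // ltW.
move: dv; rewrite /disc.
set dd := dens _ _ _ in h2 h5 *; rewrite h2 h3 in h1; lra.
Qed.

End OneSide.

Lemma sum_drift_le (R : realFieldType) (G : sgraph) (Q U S : {set G}) (p : nat) (t b : R) :
  0 <= b -> #|S| = p -> (forall u, u \in S -> p%:R * (drift R Q U u + t) <= b) ->
  \sum_(u in S) drift R Q U u + p%:R * t <= b.
Proof.
move=> b0 cS hS; have [p0|p0] := posnP p.
  move: cS; rewrite p0 => /eqP; rewrite cards_eq0 => /eqP->.
  by rewrite big_set0 mul0r addr0.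
have p0' : 0 < p%:R :> R by rewrite ltr0n.
rewrite -(ler_pM2l p0') mulrDr mulr_sumr.
have -> : p%:R * (p%:R * t) = \sum_(u in S) p%:R * t.
  by rewrite sumr_const cS -[RHS]mulr_natl.
have -> : p%:R * b = \sum_(u in S) b by rewrite sumr_const cS mulr_natl.
rewrite -big_split /=.
by apply: ler_sum => u /hS; rewrite mulrDr.
Qed.

Lemma core_degree_arith (R : realFieldType) (z g m x y : R) :
  z * g / 16 * x * (g / 4 * m) <= z * g / 16 * x * y ->
  z * g / 16 * y * (g / 4 * m) <= z * g / 16 * y * x ->
  0 < z * g * (x * y) ->
  z * g / 16 * (g / 4 * m) * (x + y) < z * (g / 4) * (x * y).
Proof. lra. Qed.

Lemma core_drift_arith (R : realFieldType) (a b x y h p q m2 sg : R) :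
  a + p * (2 * sg * m2) <= x -> b + q * (2 * sg * m2) <= y ->
  x + y = (p + q) * m2 * (2 * sg + 3 * sg ^+ 2 / 64) + h ->
  h <= (p + q) * m2 * (sg ^+ 2 / 64) ->
  a + b <= sg ^+ 2 / 16 * m2 * (p + q).
Proof. lra. Qed.

Lemma core_step_arith (R : realFieldType) (c w sg s : R) :
  0 <= c -> 0 < s -> w <= 2 -> 128 <= s * sg ^+ 2 -> c * w / s <= c * (sg ^+ 2 / 64).
Proof.
move=> c0 s0 w2 s64; rewrite ler_pdivrMr // -mulrA; apply: ler_wpM2l => //.
by lra.
Qed.

(** The component will use [p] vertices in [A] and [q] in [B], so the drifts are weighted by [p] and
    [q], after a shift by [t >= |drift|] that makes them nonnegative. For the level sets found, the
    two thresholds add up to about the sum of the two means, so any choice of [p] and [q] vertices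
    there has small total drift. *)
Lemma core_exists (R : realFieldType) (G : sgraph) (g sg m : R) (p q s : nat)
    (A B UA UB Bad : {set G}) :
  0 < g -> g <= 2^-1 -> 0 < sg -> sg <= g -> 0 < m -> #|G|%:R <= 2 * m ->
  [disjoint A & B] -> UA \subset A -> UB \subset B ->
  energy R A UA <= sg ^+ 2 * m ^+ 3 -> energy R B UB <= sg ^+ 2 * m ^+ 3 ->
  #|Bad|%:R <= sg * g / 256 * m ->
  g / 2 * m <= #|A :\: UA|%:R -> g / 2 * m <= #|B :\: UB|%:R ->
  (forall v, v \in B -> v \notin Bad ->
     disc R A UA v <= g ^+ 2 / 32 * m /\ 2^-1 + g / 2 <= dens R A v) ->
  (forall v, v \in A -> v \notin Bad ->
     disc R B UB v <= g ^+ 2 / 32 * m /\ 2^-1 + g / 2 <= dens R B v) ->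
  (0 < p + q)%N -> 128 <= s%:R * sg ^+ 2 ->
  exists Z : {set G}, [/\ Z \subset (A :\: UA :\: Bad) :|: (B :\: UB :\: Bad), Z != set0,
    forall v, v \in Z -> sg ^+ 2 * g ^+ 2 / 128 / 64 * m <= #|nbh v :&: Z|%:R &
    forall SA SB : {set G}, SA \subset Z :&: A -> SB \subset Z :&: B ->
      #|SA| = p -> #|SB| = q ->
      \sum_(u in SA) drift R A UA u + \sum_(u in SB) drift R B UB u
        <= sg ^+ 2 / 16 * m ^+ 2 * (p + q)%:R].
Proof.
move=> g0 g1 sg0 sg1 m0 Gm dAB sUA sUB eA eB cBad cA cB hB hA pq0 s64.
have sg_le1 : sg <= 1 by lra.
set X := A :\: UA :\: Bad; set Y := B :\: UB :\: Bad.
have cX : g / 4 * m <= #|X|%:R by apply: card_good cBad cA.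
have cY : g / 4 * m <= #|Y|%:R by apply: card_good cBad cB.
have gm0 : 0 < g * m by rewrite mulr_gt0.
have cX0 : 0 < #|X|%:R :> R by lra.
have cY0 : 0 < #|Y|%:R :> R by lra.
have X0 : X != set0 by move: cX0; rewrite ltr0n card_gt0.
have Y0 : Y != set0 by move: cY0; rewrite ltr0n card_gt0.
have mX : (\sum_(u in X) drift R A UA u) / #|X|%:R <= sg ^+ 2 / 32 * m ^+ 2.
  exact: mean_drift_good Gm sUA eA cBad cA.
have mY : (\sum_(u in Y) drift R B UB u) / #|Y|%:R <= sg ^+ 2 / 32 * m ^+ 2.
  exact: mean_drift_good Gm sUB eB cBad cB.
pose t := 2 * sg * m ^+ 2.
pose a u := p%:R * (drift R A UA u + t).
pose b u := q%:R * (drift R B UB u + t).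
have a0 u : 0 <= a u.
  rewrite mulr_ge0 //; have := normr_drift_le u m0 sg0 Gm eA.
  by rewrite ler_norml -/t => /andP[]; lra.
have b0 u : 0 <= b u.
  rewrite mulr_ge0 //; have := normr_drift_le u m0 sg0 Gm eB.
  by rewrite ler_norml -/t => /andP[]; lra.
have mean (V : {set G}) (f : G -> R) (k : nat) : 0 < #|V|%:R :> R ->
    (\sum_(u in V) f u) / #|V|%:R <= sg ^+ 2 / 32 * m ^+ 2 ->
    (\sum_(u in V) k%:R * (f u + t)) / #|V|%:R <= k%:R * (sg ^+ 2 / 32 * m ^+ 2 + t).
  move=> V0 hV; rewrite -mulr_sumr big_split /= sumr_const -[t *+ _]mulr_natl -mulrA.
  by rewrite ler_wpM2l // mulrDl [_ * t]mulrC mulfK ?gt_eqF // lerD2r.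
(* Of the allowed [4 sg^2 / 64] per vertex, the means use two parts; [w] adds one part to pay for
   the factor [1 - z], and the last part covers the level width [h]. *)
pose w : R := 2 * sg + 3 * sg ^+ 2 / 64.
have w0 : 0 < w by rewrite /w; have := sqr_ge0 sg; lra.
have w1 : w <= 2.
  have : sg ^+ 2 <= 1 by rewrite expr2 mulr_ile1 // ltW.
  by rewrite /w; lra.
have s0 : (0 < s)%N by case: s s64 => //; rewrite mul0r; lra.
have s0' : 0 < s%:R :> R by rewrite ltr0n.
have pq0' : 0 < (p + q)%:R :> R by rewrite ltr0n.
have m20 : 0 < m ^+ 2 by rewrite exprn_gt0.
pose h := (p + q)%:R * m ^+ 2 * w / s%:R.
have h0 : 0 < h by rewrite !mulr_gt0 ?invr_gt0.
pose z := sg ^+ 2 / 128.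
have sh : s%:R * h = (p + q)%:R * m ^+ 2 * w by rewrite /h mulrC divfK ?gt_eqF.
have z0 : 0 <= z by rewrite divr_ge0 ?sqr_ge0.
have hz : 2 * sg + sg ^+ 2 / 32 <= (1 - z) * w.
  have : z * w <= z * 2 by rewrite ler_wpM2l.
  by rewrite mulrBl mul1r {2}/w {2}/z; lra.
have pqm0 : 0 <= (p + q)%:R * m ^+ 2 by rewrite mulr_ge0 ?ltW.
have [|i si hi] := @large_level_sets R G G X Y a b h z s h0 s0 X0 Y0
    (fun u _ => a0 u) (fun u _ => b0 u).
  have hX := mean X _ p cX0 mX; have hY := mean Y _ q cY0 mY.
  apply: le_trans (lerD hX hY) _; rewrite -mulrDl -natrD sh.
  have -> : (1 - z) * ((p + q)%:R * m ^+ 2 * w) = (p + q)%:R * m ^+ 2 * ((1 - z) * w) by ring.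
  apply: le_trans (ler_wpM2l pqm0 hz).
  by rewrite /t le_eqVlt; apply/orP; left; apply/eqP; ring.
set X1 := [set x in X | _] in hi; set Y1 := [set y in Y | _] in hi.
have sX1 : X1 \subset X by apply/subsetP => u; rewrite inE => /andP[].
have sY1 : Y1 \subset Y by apply/subsetP => u; rewrite inE => /andP[].
have sXA : X \subset A by apply: subset_trans (subsetDl _ _) (subsetDl _ _).
have sYB : Y \subset B by apply: subset_trans (subsetDl _ _) (subsetDl _ _).
have dXY : [disjoint X & Y] by apply: disjointWl sXA (disjointWr sYB dAB).
have XBad u : u \in X -> u \notin Bad by rewrite !inE => /andP[].
have YBad u : u \in Y -> u \notin Bad by rewrite !inE => /andP[].
pose d := sg ^+ 2 * g ^+ 2 / 128 / 64 * m.
have d0 : 0 <= d by rewrite /d !mulr_ge0 ?sqr_ge0 ?invr_ge0 // ltW.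
have [||||Z [sZ Z0 dZ]] := @min_degree_subset_bip R G (g / 4) z d X Y X1 Y1 _ z0 X0 Y0 dXY _ _ sX1 sY1 hi d0.
- by rewrite divr_ge0 // ltW.
- move=> x xX; have [h1 h2] := hA x (subsetP sXA x xX) (XBad x xX).
  exact: degree_good g0 sg1 m0 sUB cBad cB h1 h2.
- move=> y yY; have [h1 h2] := hB y (subsetP sYB y yY) (YBad y yY).
  exact: degree_good g0 sg1 m0 sUA cBad cA h1 h2.
- have zg0 : 0 < z * g by rewrite mulr_gt0 // divr_gt0 ?exprn_gt0.
  have k1 : z * g / 16 * #|X|%:R * (g / 4 * m) <= z * g / 16 * #|X|%:R * #|Y|%:R.
    by apply: ler_wpM2l => //; apply: mulr_ge0 => //; apply: divr_ge0 => //; apply: ltW.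
  have k2 : z * g / 16 * #|Y|%:R * (g / 4 * m) <= z * g / 16 * #|Y|%:R * #|X|%:R.
    by apply: ler_wpM2l => //; apply: mulr_ge0 => //; apply: divr_ge0 => //; apply: ltW.
  have k3 : 0 < z * g * (#|X|%:R * #|Y|%:R) by apply: mulr_gt0 zg0 (mulr_gt0 cX0 cY0).
  have -> : d = z * g / 16 * (g / 4 * m) by rewrite /d /z; field.
  exact: core_degree_arith k1 k2 k3.
have Zlev u : u \in Z -> (u \in X1) || (u \in Y1) by move/(subsetP sZ); rewrite inE.
exists Z; split=> //.
  by apply: subset_trans sZ (setUSS sX1 sY1).
move=> SA SB sSA sSB cSA cSB.
have k1 : \sum_(u in SA) drift R A UA u + p%:R * t <= i.+1%:R * h.
  apply: sum_drift_le cSA _; first by rewrite mulr_ge0 // ltW.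
  move=> u /(subsetP sSA); rewrite inE => /andP[/Zlev /orP[uX|/(subsetP sY1)/(subsetP sYB) uB] uA].
    by case/setIdP: uX => _ /ltW.
  by move: dAB; rewrite disjoint_subset => /subsetP/(_ u uA); rewrite inE uB.
have k2 : \sum_(u in SB) drift R B UB u + q%:R * t <= (s - i)%:R * h.
  apply: sum_drift_le cSB _; first by rewrite mulr_ge0 // ltW.
  move=> u /(subsetP sSB); rewrite inE => /andP[/Zlev /orP[/(subsetP sX1)/(subsetP sXA) uA|uY] uB].
    by move: dAB; rewrite disjoint_subset => /subsetP/(_ u uA); rewrite inE uB.
  by case/setIdP: uY => _ /ltW.
have k3 : i.+1%:R * h + (s - i)%:R * h = s%:R * h + h.
  rewrite -mulrDl -natrD addSn (subnKC (ltnW si)).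
  by rewrite -[s.+1%:R]natr1 mulrDl mul1r.
have k4 : h <= (p + q)%:R * m ^+ 2 * (sg ^+ 2 / 64).
  exact: core_step_arith.
rewrite natrD in k4 sh *; apply: core_drift_arith k1 k2 _ k4.
by rewrite k3 sh.
Qed.

Lemma bipartition_adj (G : sgraph) (A B : {set G}) (x y : G) :
  bipartition A B -> adj x y -> (x \in A) = (y \in B).
Proof.
move=> [_ AB0 AB] xy.
have nAB v : v \in A -> v \in B -> False.
  by move=> vA vB; have : v \in A :&: B by [rewrite inE vA]; rewrite AB0 inE.
case: (AB x y xy) => [[-> ->] //|[xB yA]].
apply/idP/idP => [/nAB/(_ xB) //|/(nAB _ yA) //].
Qed.

Lemma bipartitionC (G : sgraph) (A B : {set G}) : bipartition A B -> bipartition B A.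
Proof.
move=> [ABT AB0 AB]; split; rewrite 1?setUC 1?setIC // => x y /AB[]; by [right|left].
Qed.

(** * Reservoirs and attaching a component *)

Section Reservoirs.
Variables (R : realFieldType) (G : sgraph).
Implicit Types (g sg m : R) (k : nat) (A B RA RB U Z : {set G}).

(* [RA] and [RB] are the reservoirs: two rich vertices of the same class have at
   least [g * k] common neighbours there. *)
Definition rich g k RA RB : {set G} :=
  [set v | (2^-1 + g / 2) * k%:R <= #|nbh v :&: (RA :|: RB)|%:R].

(** Poor vertices must be few on two scales: relative to [m], so that they can be discarded from the
    host graph, and relative to [k], so that most reservoir vertices are rich. *)
Record reservoirs g sg m k A B RA RB : Prop := Reservoirs {
  res_bip : bipartition A B;
  res_cardA : #|A|%:R = m;
  res_cardB : #|B|%:R = m;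
  res_deg : forall v : G, (2^-1 + g) * m <= #|nbh v|%:R;
  res_subA : RA \subset A;
  res_subB : RB \subset B;
  res_cardRA : #|RA| = k;
  res_cardRB : #|RB| = k;
  res_gt0 : (0 < k)%N;
  res_le : k%:R <= g / 4 * m;
  res_poor_m : #|~: rich g k RA RB|%:R <= sg * g / 512 * m;
  res_poor_k : #|~: rich g k RA RB|%:R <= g / 4 * k%:R
}.

Lemma reservoirsC g sg m k A B RA RB :
  reservoirs g sg m k A B RA RB -> reservoirs g sg m k B A RB RA.
Proof.
have E : rich g k RB RA = rich g k RA RB by rewrite /rich [RB :|: RA]setUC.
case=> *; split; rewrite ?E //; exact: bipartitionC.
Qed.

Lemma nbh_bip A B v : bipartition A B -> v \in B -> nbh v \subset A.
Proof.
move=> bAB vB; apply/subsetP => u; rewrite inE => vu.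
by rewrite (bipartition_adj bAB (y := v)) // adj_sym.
Qed.

Lemma dens_diff g sg m k A B RA RB v : 0 < g -> g <= 2^-1 -> 0 < m ->
  reservoirs g sg m k A B RA RB -> v \in B -> 2^-1 + g / 2 <= dens R (A :\: RA) v.
Proof.
move=> g0 g1 m0 [bAB cA cB deg sA sB cRA cRB k0 kle _ _] vB.
have cAD : #|A :\: RA|%:R = m - k%:R.
  by rewrite -cA -cRA cardsD (setIidPr sA) natrB // subset_leq_card.
have gm : g * m <= 2^-1 * m by rewrite ler_wpM2r // ltW.
rewrite /dens cAD ler_pdivlMr; last by lra.
have h : #|nbh v|%:R <= #|nbh v :&: (A :\: RA)|%:R + k%:R :> R.
  rewrite -natrD ler_nat -cRA -(cardsID RA (nbh v)) addnC leq_add //.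
    by rewrite subset_leq_card //; apply/subsetP => u; rewrite !inE => /andP[-> vu];
      rewrite vu (subsetP (nbh_bip bAB vB)) // inE.
  by rewrite subset_leq_card ?subsetIr.
have := deg v; have gk : 0 <= g * k%:R by rewrite mulr_ge0 // ltW.
have gm0 : 0 < g * m by rewrite mulr_gt0.
by lra.
Qed.

(** Two rich vertices of [A] share at least [g * k] neighbours in [RB]. At most [g / 4 * k] of these
    are poor and as many used, so [x] and each vertex of [Z] in [A] share [g / 2 * k] available
    ones. Averaging over the available neighbours of [x] gives [u]. *)
Lemma attaching_vertex g sg m k A B RA RB U Z (d : R) x :
  reservoirs g sg m k A B RA RB -> 0 < g ->
  x \in A -> x \in rich g k RA RB -> #|U :&: (RA :|: RB)|%:R <= g / 4 * k%:R ->
  Z != set0 -> 0 < d -> (forall z, z \in Z -> d <= #|nbh z :&: Z|%:R) ->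
  (forall z, z \in Z -> [/\ z \in rich g k RA RB, z \notin RA :|: RB & z \notin U]) ->
  exists u, [/\ u \in (rich g k RA RB :&: (RA :|: RB)) :\: U, adj x u
    & g / 2 * d <= #|nbh u :&: Z|%:R].
Proof.
move=> res g0 xA xrich cUR Z0 d0 dZ ZP.
have [bAB cA cB deg sA sB cRA cRB k0 kle poor_m poor_k] := res.
pose Av := (nbh x :&: (RA :|: RB)) :&: rich g k RA RB :\: U.
have nonempty (V : {set G}) : d <= #|V|%:R -> V != set0.
  by move=> hV; rewrite -card_gt0 -(ltr0n R); apply: lt_le_trans hV.
(* [Z] meets [B] because it has edges, and the [d] neighbours in [Z] of such a vertex lie in [A]. *)
have ZA : d <= #|Z :&: A|%:R.
  case/set0Pn: Z0 => z0 z0Z; have [ABT _ _] := bAB.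
  have [z1 z1Z z1B] : exists2 z1, z1 \in Z & z1 \in B.
    have : z0 \in A :|: B by rewrite ABT.
    case/setUP => [z0A|]; last by exists z0.
    have /set0Pn[z1] := nonempty _ (dZ _ z0Z).
    rewrite !inE => /andP[z01 z1Z]; exists z1 => //.
    by rewrite -(bipartition_adj bAB z01).
  apply: le_trans (dZ _ z1Z) _; rewrite ler_nat subset_leq_card //.
  by apply/subsetP => v /setIP[vN vZ]; rewrite inE vZ (subsetP (nbh_bip bAB z1B)).
have RBE v : v \in A -> nbh v :&: (RA :|: RB) \subset RB.
  move=> vA; apply/subsetP => w /setIP[vw /setUP[wA|//]].
  have := subsetP (nbh_bip (bipartitionC bAB) vA) w vw.
  have [_ AB0 _] := bAB => wB.
  have : w \in A :&: B by rewrite inE wB (subsetP sA).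
  by rewrite AB0 inE.
have k0' : 0 < k%:R :> R by rewrite ltr0n.
have hZ z : z \in Z :&: A -> g / 2 * k%:R <= #|nbh z :&: Av|%:R.
  case/setIP => zZ zA; have [zrich _ _] := ZP z zZ.
  set Nx := nbh x :&: (RA :|: RB); set Nz := nbh z :&: (RA :|: RB).
  have h1 : #|Nx|%:R + #|Nz|%:R <= #|Nx :&: Nz|%:R + k%:R :> R.
    rewrite -!natrD ler_nat -cardsUI addnC leq_add2l -cRB.
    by rewrite subset_leq_card // subUset !RBE.
  have h2 : #|Nx :&: Nz|%:R <= #|nbh z :&: Av|%:R +
      (#|~: rich g k RA RB|%:R + #|U :&: (RA :|: RB)|%:R) :> R.
    rewrite -!natrD ler_nat -(cardsID Av (Nx :&: Nz)) leq_add //.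
      rewrite subset_leq_card //; apply/subsetP => w.
      by rewrite !inE => /andP[/andP[_ /andP[-> _]] ->].
    apply: leq_trans (leq_card_setU _ _); rewrite subset_leq_card //.
    apply/subsetP => w; rewrite /Nx /Nz /Av in_setU in_setC in_setD !in_setI in_setD !in_setI.
    case: (w \in rich _ _ _ _); case: (w \in U); case: (w \in RA :|: RB) => //=;
    by rewrite ?andbF ?andbT //= => /andP[/negbTE->].
  move: xrich zrich; rewrite !inE -/Nx -/Nz; lra.
have cAv : #|Av|%:R <= k%:R :> R.
  rewrite ler_nat -cRB subset_leq_card //; apply: subset_trans (RBE x xA).
  by apply: subset_trans (subsetDl _ _) (subsetIl _ _).
have Av0 : Av != set0.
  have /set0Pn[z /hZ hz] := nonempty _ ZA.
  have : 0 < #|nbh z :&: Av|%:R :> R.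
    by apply: lt_le_trans hz; rewrite mulr_gt0 // divr_gt0.
  rewrite ltr0n card_gt0 => /set0Pn[w /setIP[_ wAv]].
  by apply/set0Pn; exists w.
have [z zZA|u uAv uZ] := common_neighbor (d := g / 2) Av0 (X := Z :&: A).
  by apply: le_trans (hZ z zZA); rewrite ler_wpM2l // divr_ge0 // ltW.
exists u; move: uAv; rewrite /Av !in_setD !in_setI => /andP[-> /andP[/andP[xu ->] ->]].
split=> //; first by rewrite inE in xu.
apply: le_trans (ler_wpM2l _ ZA) (le_trans uZ _); first by rewrite divr_ge0 // ltW.
by rewrite ler_nat subset_leq_card // setIS // subsetIl.
Qed.

(* [sg] is [(g ^+ 2 / 32) ^+ 2 * g / 512]: by Chebyshev's inequality the energy
   bound then leaves at most [sg * g / 1024 * m] vertices whose discrepancy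
   exceeds [g ^+ 2 / 32 * m], and discarding them raises the mean drift by much
   less than the [sg ^+ 2 / 16 * m ^+ 2] allowed per vertex. *)
Lemma host_step g sg m k A B RA RB (U : {set G}) (x : G) (p q s : nat) :
  reservoirs g sg m k A B RA RB ->
  0 < g -> g <= 2^-1 -> sg = g ^+ 5 / 1024 / 512 -> 0 < m -> 128 <= s%:R * sg ^+ 2 ->
  let A0 := A :\: RA in let B0 := B :\: RB in
  #|U :&: A0|%:R <= (1 - g) * m -> #|U :&: B0|%:R <= (1 - g) * m ->
  #|U :&: (RA :|: RB)|%:R <= g / 4 * k%:R -> x \in rich g k RA RB ->
  energy R A0 (U :&: A0) + energy R B0 (U :&: B0) <= sg ^+ 2 / 2 * m ^+ 3 ->
  exists (u : G) (Z : {set G}),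
    [/\ u \in (rich g k RA RB :&: (RA :|: RB)) :\: U, adj x u,
        Z \subset (rich g k RA RB :\: (RA :|: RB)) :\: U,
        g ^+ 3 * sg ^+ 2 / 128 / 128 * m <= #|nbh u :&: Z|%:R
      & (forall z, z \in Z -> g ^+ 3 * sg ^+ 2 / 128 / 128 * m <= #|nbh z :&: Z|%:R) /\
        forall SA SB : {set G}, SA \subset Z :&: A0 -> SB \subset Z :&: B0 ->
          #|SA| = p -> #|SB| = q ->
          \sum_(v in SA) drift R A0 (U :&: A0) v + \sum_(v in SB) drift R B0 (U :&: B0) v
            <= sg ^+ 2 / 16 * m ^+ 2 * (p + q)%:R].
Proof.
move=> res g0 g1 sgE m0 s64 A0 B0 cUA cUB cUR xrich eU.
have sg0 : 0 < sg by rewrite sgE !divr_gt0 ?exprn_gt0.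
have sg1 : sg <= g.
  have : g ^+ 4 <= 1 by rewrite exprn_ile1 ?(ltW g0) //; lra.
  by move/(ler_wpM2l (ltW g0)); rewrite sgE -exprS; lra.
pose UA := U :&: A0; pose UB := U :&: B0; rewrite -/UA -/UB in cUA cUB eU *.
have [bAB cA cB deg sA sB cRA cRB k0 kle poor_m poor_k] := res.
have Gm : #|G|%:R <= 2 * m.
  have [ABT AB0 _] := bAB.
  rewrite -cardsT -ABT cardsU AB0 cards0 subn0 natrD cA cB; lra.
pose e := g ^+ 2 / 32 * m.
have e0 : 0 < e by rewrite mulr_gt0 // divr_gt0 // exprn_gt0.
pose BA := [set v | e < disc R A0 UA v]; pose BB := [set v | e < disc R B0 UB v].
pose Bad := BA :|: BB :|: ~: rich g k RA RB.
have m3 : 0 < m ^+ 3 by rewrite exprn_gt0.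
have sg2 : 0 < sg ^+ 2 by rewrite exprn_gt0.
have sgm3 : 0 < sg ^+ 2 * m ^+ 3 by rewrite mulr_gt0.
have eA : energy R A0 UA <= sg ^+ 2 * m ^+ 3 by have := energy_ge0 R B0 UB; lra.
have eB : energy R B0 UB <= sg ^+ 2 * m ^+ 3 by have := energy_ge0 R A0 UA; lra.
have cBad : #|Bad|%:R <= sg * g / 256 * m.
  have h1 := card_disc_gt A0 UA e0; have h2 := card_disc_gt B0 UB e0.
  have h3 : (#|BA| + #|BB|)%:R * e ^+ 2 <= (sg * g / 1024 * m) * e ^+ 2.
    have -> : (sg * g / 1024 * m) * e ^+ 2 = sg ^+ 2 / 2 * m ^+ 3.
      by rewrite /e {2}sgE expr2 {1}sgE; field.
    by apply: le_trans eU; rewrite natrD mulrDl; apply: lerD.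
  rewrite ler_pM2r ?exprn_gt0 // in h3.
  have h4 : #|Bad|%:R <= (#|BA| + #|BB|)%:R + #|~: rich g k RA RB|%:R :> R.
    by rewrite -natrD ler_nat (leq_trans (leq_card_setU _ _)) // leq_add2r leq_card_setU.
  have : 0 < sg * g * m by rewrite !mulr_gt0.
  by lra.
have dAB : [disjoint A0 & B0].
  apply: disjointWl (subsetDl _ _) (disjointWr (subsetDl _ _) _).
  by rewrite -setI_eq0; case: bAB => _ ->.
have sUA : UA \subset A0 by apply: subsetIr.
have sUB : UB \subset B0 by apply: subsetIr.
have card_free (V RV : {set G}) : #|V|%:R = m -> RV \subset V -> #|RV| = k ->
    #|U :&: (V :\: RV)|%:R <= (1 - g) * m ->
    g / 2 * m <= #|(V :\: RV) :\: (U :&: (V :\: RV))|%:R.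
  move=> cV sRV cRV cU.
  have c1 : #|V :\: RV|%:R = m - k%:R.
    by rewrite -cV -cRV cardsD (setIidPr sRV) natrB // subset_leq_card.
  have sub : U :&: (V :\: RV) \subset V :\: RV by apply: subsetIr.
  rewrite [#|_ :\: (U :&: _)|]cardsD (setIidPr sub) natrB ?subset_leq_card // c1.
  have : 0 < g * m by rewrite mulr_gt0.
  by lra.
have cA0 := card_free A RA cA sA cRA cUA; have cB0 := card_free B RB cB sB cRB cUB.
have notBad v : v \notin Bad ->
    [/\ disc R A0 UA v <= e, disc R B0 UB v <= e & v \in rich g k RA RB].
  by rewrite !in_setU !negb_or !inE negbK -!leNgt => /andP[/andP[]].
have core (p' q' : nat) := @core_exists R G g sg m p' q' s A0 B0 UA UB Bad
  g0 g1 sg0 sg1 m0 Gm dAB sUA sUB eA eB cBad cA0 cB0.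
have hB v : v \in B0 -> v \notin Bad ->
    disc R A0 UA v <= g ^+ 2 / 32 * m /\ 2^-1 + g / 2 <= dens R A0 v.
  move=> /setDP[vB _] /notBad[? _ _]; split=> //; exact: dens_diff res vB.
have hA v : v \in A0 -> v \notin Bad ->
    disc R B0 UB v <= g ^+ 2 / 32 * m /\ 2^-1 + g / 2 <= dens R B0 v.
  move=> /setDP[vA _] /notBad[_ ? _]; split=> //.
  exact: dens_diff (reservoirsC res) vA.
have {core} [Z [sZ Z0 dZ driftZ]] : exists Z : {set G},
    [/\ Z \subset (A0 :\: UA :\: Bad) :|: (B0 :\: UB :\: Bad), Z != set0,
    forall v, v \in Z -> sg ^+ 2 * g ^+ 2 / 128 / 64 * m <= #|nbh v :&: Z|%:R &
    forall SA SB : {set G}, SA \subset Z :&: A0 -> SB \subset Z :&: B0 ->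
      #|SA| = p -> #|SB| = q ->
      \sum_(v in SA) drift R A0 UA v + \sum_(v in SB) drift R B0 UB v
        <= sg ^+ 2 / 16 * m ^+ 2 * (p + q)%:R].
  (* If the component consists of its top only, the level argument has no weights; running it for
     one dummy vertex still supplies [Z], and the drift claim is empty. *)
  have [pq0|pq0] := posnP (p + q); last exact: core.
  have [Z [sZ Z0 dZ _]] := core 1 0 hB hA isT s64.
  exists Z; split=> // SA SB _ _ cSA cSB.
  move/eqP: pq0; rewrite addn_eq0 => /andP[/eqP p0 /eqP q0].
  rewrite p0 in cSA; rewrite q0 in cSB; rewrite (cards0_eq cSA) (cards0_eq cSB).
  by rewrite !big_set0 addr0 p0 q0 mulr0.
have ZP z : z \in Z -> [/\ z \in rich g k RA RB, z \notin RA :|: RB & z \notin U].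
  move/(subsetP sZ); have [_ AB0' _] := bAB.
  case/setUP => /setDP[/setDP[zQ zU] /notBad[_ _ ->]]; split=> //.
  - move: zQ; rewrite !inE negb_or => /andP[-> zA] /=.
    apply/negP => /(subsetP sB) zB; have : z \in A :&: B by rewrite inE zA.
    by rewrite AB0' inE.
  - by apply: contra zU => zU; rewrite inE zU.
  - move: zQ; rewrite !inE negb_or => /andP[-> zB] /=; rewrite andbT.
    apply/negP => /(subsetP sA) zA; have : z \in A :&: B by rewrite inE zA.
    by rewrite AB0' inE.
  - by apply: contra zU => zU; rewrite inE zU.
have [u [uP xu uZ]] : exists u, [/\ u \in (rich g k RA RB :&: (RA :|: RB)) :\: U, adj x u
    & g / 2 * (sg ^+ 2 * g ^+ 2 / 128 / 64 * m) <= #|nbh u :&: Z|%:R].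
  have d0 : 0 < sg ^+ 2 * g ^+ 2 / 128 / 64 * m.
    by rewrite mulr_gt0 // !divr_gt0 // mulr_gt0 // exprn_gt0.
  have [ABT _ _] := bAB; have : x \in A :|: B by rewrite ABT.
  case/setUP => xV; first exact: attaching_vertex res g0 xV xrich cUR Z0 d0 dZ ZP.
  have E : rich g k RB RA = rich g k RA RB by rewrite /rich [RB :|: RA]setUC.
  rewrite -E [RA :|: RB]setUC in xrich cUR ZP *.
  exact: attaching_vertex (reservoirsC res) g0 xV xrich cUR Z0 d0 dZ ZP.
exists u, Z; split=> //.
- apply/subsetP => z zZ; have [h1 h2 h3] := ZP z zZ.
  by rewrite in_setD h3 in_setD h2 h1.
- by apply: le_trans uZ; rewrite le_eqVlt; apply/orP; left; apply/eqP; field.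
split=> // z zZ; apply: le_trans (dZ z zZ).
have h0 : 0 <= sg ^+ 2 * g ^+ 2 * m / 128 / 64.
  by rewrite !divr_ge0 // !mulr_ge0 ?sqr_ge0 // ltW.
have h1 : g * (sg ^+ 2 * g ^+ 2 * m / 128 / 64) <= 2 * (sg ^+ 2 * g ^+ 2 * m / 128 / 64).
  by rewrite ler_wpM2r //; move: g1; clear; lra.
by move: h1; clear; lra.
Qed.

End Reservoirs.

(** The degree condition predicts at least [(2^-1 + g) * k] neighbours in [RA], and a poor vertex
    has fewer than [(2^-1 + g / 2) * k]. *)
Lemma disc_poor (R : realFieldType) (G : sgraph) (g m : R) (k : nat)
    (A B RA RB : {set G}) v :
  bipartition A B -> 0 < g -> 0 < m -> #|A|%:R = m -> (2^-1 + g) * m <= #|nbh v|%:R ->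
  RA \subset A -> #|RA| = k -> v \in B -> v \notin rich g k RA RB ->
  disc R A RA v < - (g / 2 * k%:R).
Proof.
move=> bAB g0 m0 cA deg sA cRA vB; rewrite inE -ltNge => poor.
have hd : 2^-1 + g <= dens R A v.
  by rewrite /dens (setIidPl (nbh_bip bAB vB)) cA ler_pdivlMr.
have hk : (2^-1 + g) * k%:R <= dens R A v * k%:R by rewrite ler_wpM2r.
have hR : #|nbh v :&: RA|%:R <= #|nbh v :&: (RA :|: RB)|%:R :> R.
  by rewrite ler_nat subset_leq_card // setIS // subsetUl.
by rewrite /disc cRA; lra.
Qed.

(** Low-energy sets of size [k] have energy at most [2 * m * k]. Chebyshev's inequality at
    [g / 2 * k], applied in both classes, leaves at most [16 * m / (g^2 * k)] poor vertices, and the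
    last two hypotheses compare this with the two required bounds. *)
Lemma reservoirs_exist (R : realFieldType) (G : sgraph) (g sg m : R) (k : nat)
    (A B : {set G}) :
  bipartition A B -> #|A|%:R = m -> #|B|%:R = m ->
  (forall v : G, (2^-1 + g) * m <= #|nbh v|%:R) ->
  0 < g -> g <= 2^-1 -> 0 < m -> (0 < k)%N -> k%:R <= g / 4 * m ->
  16 * m <= (sg * g / 512 * m) * (g ^+ 2 * k%:R) ->
  16 * m <= (g / 4 * k%:R) * (g ^+ 2 * k%:R) ->
  exists RA RB, reservoirs g sg m k A B RA RB.
Proof.
move=> bAB cA cB deg g0 g1 m0 k0 kle h1 h2.
have k0' : 0 < k%:R :> R by rewrite ltr0n.
have km : k%:R <= m.
  apply: le_trans kle _; rewrite -[leRHS]mul1r ler_wpM2r ?(ltW m0) //.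
  by move: g1; clear; lra.
have kA : (k <= #|A|)%N by rewrite -(ler_nat R) cA.
have kB : (k <= #|B|)%N by rewrite -(ler_nat R) cB.
have [RA [sA cRA eA]] := low_energy_subset R kA.
have [RB [sB cRB eB]] := low_energy_subset R kB.
have cG : #|G|%:R = 2 * m.
  have [ABT AB0 _] := bAB.
  by rewrite -cardsT -ABT cardsU AB0 cards0 subn0 natrD cA cB mulr2n mulrDl !mul1r.
rewrite cG in eA eB.
pose t := g / 2 * k%:R.
have t0 : 0 < t by rewrite mulr_gt0 // divr_gt0.
have h : #|~: rich g k RA RB|%:R * (g ^+ 2 * k%:R) <= 16 * m.
  have sub : ~: rich g k RA RB \subset
      [set v | disc R A RA v < - t] :|: [set v | disc R B RB v < - t].
    apply/subsetP => v; rewrite in_setC => poor.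
    have [ABT _ _] := bAB; have : v \in A :|: B by rewrite ABT.
    case/setUP => vV; rewrite in_setU; apply/orP; [right|left]; rewrite inE.
      apply: (disc_poor (RB := RA) (bipartitionC bAB) g0 m0) => //.
      by rewrite /rich setUC.
    exact: (disc_poor (RB := RB) bAB g0 m0).
  have c1 := card_disc_lt A RA t0; have c2 := card_disc_lt B RB t0.
  have c3 : #|~: rich g k RA RB|%:R * t ^+ 2 <= 4 * m * k%:R.
    apply: (@le_trans _ _ ((#|[set v | disc R A RA v < - t]|%:R
        + #|[set v | disc R B RB v < - t]|%:R) * t ^+ 2)).
      rewrite ler_wpM2r ?sqr_ge0 // -natrD ler_nat.
      exact: leq_trans (subset_leq_card sub) (leq_card_setU _ _).
    by rewrite mulrDl; move: c1 c2 eA eB; clear; lra.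
  rewrite -(ler_pM2r k0'); move: c3; rewrite /t; clear; lra.
have gk0 : 0 < g ^+ 2 * k%:R by rewrite mulr_gt0 // exprn_gt0.
exists RA, RB; split=> //; rewrite -(ler_pM2r gk0); exact: le_trans h _.
Qed.

(** * Embedding the tree *)

Lemma energy_setU_le (R : realFieldType) (G : sgraph) (Q U S : {set G}) (m b : R) :
  [disjoint U & S] -> 0 <= m -> #|G|%:R <= 2 * m -> #|S|%:R <= b ->
  energy R Q (U :|: S) <=
    energy R Q U + 2 * \sum_(u in S) drift R Q U u + 2 * m * (b * #|S|%:R).
Proof.
move=> dUS m0 Gm Sb; rewrite energyU // lerD2l.
apply: le_trans (energy_le R Q S) _.
apply: ler_pM => //; rewrite ?sqr_ge0 //.
by rewrite expr2 ler_wpM2r.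
Qed.

(** The budget is [sg^2 / 4 * m^2] per embedded vertex: twice the drift takes [sg^2 / 8], and the
    second-order term [2 * m * t] at most [sg^2 / 64]. *)
Lemma energy_growth_arith (R : realFieldType) (e0 e1 e0' e1' d0 d1 p q a b m sg t : R) :
  e0' <= e0 + 2 * d0 + 2 * m * (t * p) ->
  e1' <= e1 + 2 * d1 + 2 * m * (t * q) ->
  d0 + d1 <= sg ^+ 2 / 16 * m ^+ 2 * (p + q) ->
  0 <= m -> 0 <= p + q -> t <= sg ^+ 2 / 128 * m ->
  e0 + e1 <= sg ^+ 2 / 4 * m ^+ 2 * (a + b) ->
  e0' + e1' <= sg ^+ 2 / 4 * m ^+ 2 * (a + p + (b + q)).
Proof.
move=> h0 h1 h2 m0 pq0 /(ler_wpM2l (mulr_ge0 m0 pq0)) h4 h5.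
have : 0 <= sg ^+ 2 * (m * (m * (p + q))) by rewrite mulr_ge0 ?sqr_ge0 ?mulr_ge0.
by lra.
Qed.

Section PartialEmbeddings.
Variables (R : realFieldType) (G : sgraph) (g sg m : R) (k : nat) (A B RA RB : {set G}).
Variables (T : finType) (r : T) (par : T -> T) (dep : T -> nat) (W P : {set T}).

Local Notation A0 := (A :\: RA).
Local Notation B0 := (B :\: RB).

(* The top vertices of the components are exactly those placed in the reservoirs;
   only the other vertices are counted in the energy. *)
Record partial_embedding (D : {set T}) (f : T -> G) : Prop := PartialEmbedding {
  pe_root : r \in D;
  pe_par : {in D, forall w, par w \in D};
  pe_seed : forall w, par w \in D -> par w \notin W -> w \in D;
  pe_inj : {in D &, injective f};
  pe_adj : {in D, forall w, w != r -> adj (f w) (f (par w))};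
  pe_side : {in D, forall w, (f w \in A) = (w \in P)};
  pe_res : {in D, forall w, (f w \in RA :|: RB) = is_top r par W w};
  pe_rich : {in D, forall w, f w \in rich g k RA RB};
  pe_energy : let U := f @: D in
    energy R A0 (U :&: A0) + energy R B0 (U :&: B0)
      <= sg ^+ 2 / 4 * m ^+ 2 * (#|U :&: A0|%:R + #|U :&: B0|%:R)
}.

(** An unembedded vertex [y] of least depth has an embedded parent, which is a seed because [D]
    consists of whole components. So [y] is the top of a wholly unembedded component; [y] goes to
    the reservoir vertex [u] and the rest into [Z]. *)
Lemma extend_partial_embedding (s : nat) (D : {set T}) (f : T -> G) :
  reservoirs g sg m k A B RA RB ->
  0 < g -> g <= 2^-1 -> sg = g ^+ 5 / 1024 / 512 -> 0 < m -> 128 <= s%:R * sg ^+ 2 ->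
  par r = r -> (forall v, v != r -> (dep (par v) < dep v)%N) ->
  (forall w, w != r -> (par w \in P) = (w \notin P)) ->
  #|P|%:R <= (1 - g) * m -> #|~: P|%:R <= (1 - g) * m ->
  #|[set w | is_top r par W w]|%:R <= g / 4 * k%:R ->
  (forall y, #|[set w | top r par dep W w == y]|%:R <= g ^+ 3 * sg ^+ 2 / 128 / 128 * m) ->
  partial_embedding D f -> D != setT ->
  exists (D' : {set T}) (f' : T -> G), partial_embedding D' f' /\ D \proper D'.
Proof.
move=> res g0 g1 sgE m0 s64 parr dep_par sideP cP cP' ctop ccomp pe Dnt.
have [rD parD seedD injf adjf sidef resf richf enf] := pe.
have [bAB cA cB deg sA sB cRA cRB k0 kle _ _] := res.
have [ABT AB0 _] := bAB.
have inAB v : (v \in B) = (v \notin A).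
  have : v \in A :|: B by rewrite ABT.
  have : v \in A :&: B = false by rewrite AB0 inE.
  by rewrite inE in_setU; case: (v \in A); case: (v \in B).
have resA0 v : v \in A -> v \notin RA :|: RB -> v \in A0.
  by rewrite in_setU negb_or !inE => -> /andP[->].
have resB0 v : v \in B -> v \notin RA :|: RB -> v \in B0.
  by rewrite in_setU negb_or !inE => -> /andP[_ ->].
have A0P v : v \in A0 -> v \in A /\ v \notin RA :|: RB.
  rewrite in_setD in_setU negb_or => /andP[-> vA]; split=> //=.
  by apply: contraL vA => /(subsetP sB); rewrite inAB.
have B0P v : v \in B0 -> v \in B /\ v \notin RA :|: RB.
  rewrite in_setD in_setU negb_or => /andP[-> vB]; split=> //; rewrite andbT.
  by apply: contraL vB => /(subsetP sA); rewrite inAB negbK.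
pose U := f @: D.
have cUA : #|U :&: A0|%:R <= (1 - g) * m.
  apply: le_trans cP; rewrite ler_nat.
  apply: leq_trans (subset_leq_card _) (leq_imset_card f P).
  apply/subsetP => v /setIP[/imsetP[w wD ->] /A0P[wA _]].
  by apply: imset_f; rewrite -sidef.
have cUB : #|U :&: B0|%:R <= (1 - g) * m.
  apply: le_trans cP'; rewrite ler_nat.
  apply: leq_trans (subset_leq_card _) (leq_imset_card f (~: P)).
  apply/subsetP => v /setIP[/imsetP[w wD ->] /B0P[wB _]].
  by apply: imset_f; rewrite in_setC -sidef // -inAB.
have cUR : #|U :&: (RA :|: RB)|%:R <= g / 4 * k%:R.
  apply: le_trans ctop; rewrite ler_nat.
  apply: leq_trans (subset_leq_card _) (leq_imset_card f _).
  apply/subsetP => v /setIP[/imsetP[w wD ->] wR].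
  by apply: imset_f; rewrite inE -resf.
(* The budget per vertex, times fewer than [2 * m] used vertices, never exceeds what the host step
   tolerates. *)
have eU : energy R A0 (U :&: A0) + energy R B0 (U :&: B0) <= sg ^+ 2 / 2 * m ^+ 3.
  apply: le_trans enf _; rewrite -/U.
  have h : #|U :&: A0|%:R + #|U :&: B0|%:R <= 2 * m.
    have : 0 < g * m by rewrite mulr_gt0.
    by move: cUA cUB; lra.
  have h0 : 0 <= sg ^+ 2 / 4 * m ^+ 2 by rewrite mulr_ge0 ?divr_ge0 ?sqr_ge0.
  by move/(ler_wpM2l h0): h; lra.
have [y0 y0D] : exists y, y \notin D.
  by apply/existsP; rewrite -negb_forall; apply: contra Dnt => /forallP DT;
    apply/eqP/setP => w; rewrite inE DT.
case: (@arg_minnP _ y0 (fun y => y \notin D) dep y0D) => y yD ymin.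
have yr : y != r by apply: contraNneq yD => ->.
have pyD : par y \in D.
  by apply: contraLR (dep_par y yr) => /ymin; rewrite -leqNgt.
have pyW : par y \in W by apply: contraNT yD => /(seedD _ pyD).
have topy : is_top r par W y by rewrite /is_top pyW orbT.
pose C := [set w | top r par dep W w == y].
have yC : y \in C by rewrite inE (topE dep_par) topy.
have CP w : w \in C -> w != y ->
    [/\ ~~ is_top r par W w, w != r & par w \in C].
  rewrite !inE (topE dep_par); case: ifPn => [_ /eqP-> /eqP //|nt tw wy].
  by split=> //; case/norP: nt.
have CnD w : w \in C -> w \notin D.
  rewrite inE => /eqP tw; apply: contraNN yD => wD.
  by rewrite -tw; apply: fconnect_closed parD wD (fconnect_top dep_par _ _).
have DnC w : w \in D -> w \notin C by apply: contraL => /CnD.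
(* The top is left out: it goes to a reservoir and does not enter the energy. *)
pose CA := (C :\ y) :&: P; pose CB := (C :\ y) :\: P.
have [u [Z [uP xu sZ uZ [dZ driftZ]]]] :=
  @host_step R G g sg m k A B RA RB U (f (par y)) #|CA| #|CB| s res g0 g1 sgE m0 s64
    cUA cUB cUR (richf _ pyD) eU.
have ZP z : z \in Z -> [/\ z \in rich g k RA RB, z \notin RA :|: RB & z \notin U].
  by move/(subsetP sZ); rewrite in_setD in_setD => /andP[? /andP[? ?]]; split.
move: uP; rewrite in_setD in_setI => /andP[uU /andP[urich uR]].
have uZ' : u \notin Z by apply: contraTN uR => /ZP[].
have nle (c : nat) : g ^+ 3 * sg ^+ 2 / 128 / 128 * m <= c%:R -> (#|C| <= c)%N.
  by rewrite -(ler_nat R); apply: le_trans (ccomp y).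
have [||//||z zZ|gg [ggy gginj ggZ]] :=
  @greedy_embedding T r par dep dep_par G #|C| Z u C y yC.
- by move=> w wC wy; have [_ -> ->] := CP w wC wy.
- exact: leqnn.
- exact: nle.
- by apply: nle; apply: dZ.
pose f' w := if w \in C then gg w else f w.
have f'C w : w \in C -> f' w = gg w by rewrite /f' => ->.
have f'D w : w \in D -> f' w = f w by move/DnC; rewrite /f' => /negbTE->.
pose D' := D :|: C.
have adjf' w : w \in D' -> w != r -> adj (f' w) (f' (par w)).
  case/setUP => [wD|wC] wr; first by rewrite !f'D ?parD // adjf.
  have [wy|wy] := eqVneq w y; first by rewrite wy f'C // ggy f'D // adj_sym.
  have [_ _ pC] := CP w wC wy.
  by rewrite !f'C //; case: (ggZ w wC wy).
(* Host and tree both change class along every edge, so the side is inherited from the parent. *)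
have sidef' w : w \in D' -> (f' w \in A) = (w \in P).
  elim/(par_ind dep_par): w => w IHw.
  case/setUP => [wD|wC]; first by rewrite f'D // sidef.
  have wr : w != r.
    by have [->//|wy] := eqVneq w y; case: (CP w wC wy).
  have pwD' : par w \in D'.
    rewrite in_setU; have [->|wy] := eqVneq w y; first by rewrite pyD.
    by have [_ _ ->] := CP w wC wy; rewrite orbT.
  have wD' : w \in D' by rewrite in_setU wC orbT.
  have := sideP w wr; rewrite -(IHw wr pwD').
  rewrite (bipartition_adj bAB (adjf' w wD' wr)) inAB => ->; exact: negbK.
have resf' w : w \in D' -> (f' w \in RA :|: RB) = is_top r par W w.
  case/setUP => [wD|wC]; first by rewrite f'D // resf.
  rewrite f'C //; have [->|wy] := eqVneq w y; first by rewrite ggy uR topy.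
  have [/negbTE-> _ _] := CP w wC wy.
  by have [/ZP[_ /negbTE-> _] _] := ggZ w wC wy.
have f'U w : w \in C -> f' w \notin U.
  move=> wC; rewrite f'C //; have [->|wy] := eqVneq w y; first by rewrite ggy.
  by have [/ZP[] //] := ggZ w wC wy.
have subC (V : {set T}) : V \subset C :\ y -> gg @: V \subset Z.
  move=> /subsetP sV; apply/subsetP => v /imsetP[w wV ->]; have /setD1P[wy wC] := sV w wV.
  by case: (ggZ w wC wy).
have sCA : CA \subset C :\ y by apply: subsetIl.
have sCB : CB \subset C :\ y by apply: subsetDl.
have cimg (V : {set T}) : V \subset C :\ y -> #|gg @: V| = #|V|.
  move/subsetP => sV; apply: card_in_imset => w1 w2 /sV/setD1P[_ w1C] /sV/setD1P[_ w2C].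
  exact: gginj.
have dU (V : {set T}) (X : {set G}) : V \subset C :\ y -> [disjoint U :&: X & gg @: V].
  move=> sV; rewrite disjoint_subset; apply/subsetP => v /setIP[vU _].
  by rewrite inE; apply: contraL vU => /(subsetP (subC V sV))/ZP[].
have imgU' v : v \in f' @: D' -> v \notin RA :|: RB ->
    v \in U \/ exists2 w, w \in C :\ y & v = gg w /\ (v \in A) = (w \in P).
  case/imsetP => w wD' -> wR; case/setUP: (wD') => [wD|wC].
    by left; rewrite f'D //; apply: imset_f.
  right; exists w; last by rewrite sidef' // f'C.
  apply/setD1P; split=> //; apply: contraNneq wR => wy.
  by rewrite resf' // wy topy.
have sUU' : U \subset f' @: D'.
  apply/subsetP => v /imsetP[w wD ->]; rewrite -f'D //; apply: imset_f.
  by rewrite in_setU wD.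
have ggU' (V : {set T}) : V \subset C :\ y -> gg @: V \subset f' @: D'.
  move/subsetP => sV; apply/subsetP => v /imsetP[w /sV/setD1P[_ wC] ->].
  by rewrite -f'C //; apply: imset_f; rewrite in_setU wC orbT.
have UA' : f' @: D' :&: A0 = (U :&: A0) :|: gg @: CA.
  apply/setP => v; apply/idP/idP.
    case/setIP => vU' vA0; have [vA vR] := A0P v vA0.
    case: (imgU' v vU' vR) => [vU|[w wC [vw vside]]].
      by rewrite in_setU in_setI vU vA0.
    rewrite in_setU vw; apply/orP; right; apply: imset_f.
    by rewrite in_setI wC -vside.
  case/setUP => [/setIP[/(subsetP sUU') vU' vA0]|vg].
    by rewrite in_setI vU' vA0.
  rewrite in_setI (subsetP (ggU' _ sCA)) //.
  have [_ vR _] := ZP v (subsetP (subC _ sCA) v vg); apply: resA0 => //.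
  case/imsetP: vg => w /setIP[/setD1P[_ wC] wP] ->.
  by rewrite -f'C // sidef' // in_setU wC orbT.
have UB' : f' @: D' :&: B0 = (U :&: B0) :|: gg @: CB.
  apply/setP => v; apply/idP/idP.
    case/setIP => vU' vB0; have [vB vR] := B0P v vB0.
    case: (imgU' v vU' vR) => [vU|[w wC [vw vside]]].
      by rewrite in_setU in_setI vU vB0.
    rewrite in_setU vw; apply/orP; right; apply: imset_f.
    by rewrite in_setD wC -vside -inAB vB.
  case/setUP => [/setIP[/(subsetP sUU') vU' vB0]|vg].
    by rewrite in_setI vU' vB0.
  rewrite in_setI (subsetP (ggU' _ sCB)) //.
  have [_ vR _] := ZP v (subsetP (subC _ sCB) v vg); apply: resB0 => //.
  case/imsetP: vg => w /setDP[/setD1P[_ wC] wP] ->.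
  by rewrite -f'C // inAB sidef' // in_setU wC orbT.
have sgA : gg @: CA \subset Z :&: A0.
  rewrite subsetI subC //; apply: (@subset_trans _ _ (f' @: D' :&: A0)).
    by rewrite UA' subsetUr.
  exact: subsetIr.
have sgB : gg @: CB \subset Z :&: B0.
  rewrite subsetI subC //; apply: (@subset_trans _ _ (f' @: D' :&: B0)).
    by rewrite UB' subsetUr.
  exact: subsetIr.
have drift := driftZ _ _ sgA sgB (cimg _ sCA) (cimg _ sCB).
exists D', f'; split; last first.
  apply/properP; split; first exact: subsetUl.
  by exists y => //; rewrite in_setU yC orbT.
split=> //.
- by rewrite in_setU rD.
- move=> w /setUP[wD|wC]; first by rewrite in_setU parD.
  rewrite in_setU; have [->|wy] := eqVneq w y; first by rewrite pyD.
  by have [_ _ ->] := CP w wC wy; rewrite orbT.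
- move=> w /setUP[pD|pC] pW; first by rewrite in_setU seedD.
  have [->|wr] := eqVneq w r; first by rewrite in_setU rD.
  rewrite in_setU [w \in C]inE (topE dep_par) /is_top (negbTE wr) (negbTE pW) /=.
  by move: pC; rewrite inE => ->; rewrite orbT.
- move=> w1 w2 /setUP[w1D|w1C] /setUP[w2D|w2C].
  + by rewrite !f'D //; apply: injf.
  + by move=> E; have := f'U w2 w2C; rewrite -E f'D // imset_f.
  + by move=> E; have := f'U w1 w1C; rewrite E f'D // imset_f.
  + by rewrite !f'C //; apply: gginj.
- move=> w /setUP[wD|wC]; first by rewrite f'D // richf.
  rewrite f'C //; have [->|wy] := eqVneq w y; first by rewrite ggy.
  by have [/ZP[] //] := ggZ w wC wy.
rewrite /= UA' UB'.
have cardU' (X : {set G}) (V : {set T}) : V \subset C :\ y ->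
    #|(U :&: X) :|: gg @: V|%:R = #|U :&: X|%:R + #|V|%:R :> R.
  by move=> sV; rewrite cardsU (disjoint_setI0 (dU V X sV)) cards0 subn0 cimg // natrD.
rewrite !cardU' //.
have Gm : #|G|%:R <= 2 * m.
  by rewrite -cardsT -ABT cardsU AB0 cards0 subn0 natrD cA cB; lra.
have cV (V : {set T}) : V \subset C :\ y -> #|gg @: V|%:R <= g ^+ 3 * sg ^+ 2 / 128 / 128 * m.
  move=> sV; apply: le_trans (ccomp y); rewrite cimg // ler_nat subset_leq_card //.
  exact: subset_trans sV (subsetDl _ _).
have := energy_setU_le A0 (dU CA A0 sCA) (ltW m0) Gm (cV _ sCA).
have := energy_setU_le B0 (dU CB B0 sCB) (ltW m0) Gm (cV _ sCB).
rewrite !cimg // natrD in drift * => hB hA.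
apply: energy_growth_arith hA hB drift (ltW m0) _ _ enf; first by rewrite addr_ge0.
have g3 : g ^+ 3 <= 1 by rewrite exprn_ile1 ?(ltW g0) //; lra.
have h : 0 <= sg ^+ 2 / 128 * m by rewrite mulr_ge0 ?divr_ge0 ?sqr_ge0 // ltW.
have := ler_wpM2r h g3; lra.
Qed.

End PartialEmbeddings.

(** The start is the component of the root alone, which is a seed, placed at a rich vertex of [RA];
    components are then added until the tree is exhausted. *)
Lemma embedding_exists (R : realFieldType) (G : sgraph) (g sg m : R) (k s : nat)
    (A B RA RB : {set G}) (T : finType) (r : T) (par : T -> T) (dep : T -> nat)
    (W P : {set T}) :
  reservoirs g sg m k A B RA RB ->
  0 < g -> g <= 2^-1 -> sg = g ^+ 5 / 1024 / 512 -> 0 < m -> 128 <= s%:R * sg ^+ 2 ->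
  par r = r -> (forall v, v != r -> (dep (par v) < dep v)%N) ->
  (forall w, w != r -> (par w \in P) = (w \notin P)) ->
  #|P|%:R <= (1 - g) * m -> #|~: P|%:R <= (1 - g) * m ->
  #|[set w | is_top r par W w]|%:R <= g / 4 * k%:R ->
  (forall y, #|[set w | top r par dep W w == y]|%:R <= g ^+ 3 * sg ^+ 2 / 128 / 128 * m) ->
  r \in W -> r \in P ->
  exists f : T -> G, [/\ injective f, forall w, w != r -> adj (f w) (f (par w)) & f r \in A].
Proof.
move=> res g0 g1 sgE m0 s128 parr dep_par sideP cP cP' ctop ccomp rW rP.
have full f D : partial_embedding g sg m k A B RA RB r par W P D f ->
    exists f', partial_embedding g sg m k A B RA RB r par W P [set: T] f'.
  have [l] := ubnP #|~: D|; elim: l D f => // l IHl D f; rewrite ltnS => Dl pe.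
  have [DT|Dnt] := eqVneq D [set: T]; first by exists f; rewrite -DT.
  have [D' [f' [pe' pDD']]] := extend_partial_embedding res g0 g1
    sgE m0 s128 parr dep_par sideP cP cP' ctop ccomp pe Dnt.
  have cD : (#|~: D'| < #|~: D|)%N by rewrite proper_card // properC.
  exact: IHl (leq_trans cD Dl) pe'.
have [bAB cA cB deg sA sB cRA cRB k0 kle _ poor_k] := res.
have [ABT AB0 _] := bAB.
(* At most [g / 4 * k < k] vertices are poor, so they cannot fill [RA]. *)
have [a aRA arich] : exists2 a, a \in RA & a \in rich g k RA RB.
  have [/exists_inP //|] := boolP [exists a in RA, a \in rich g k RA RB].
  move/exists_inPn => none; exfalso.
  have : #|RA|%:R <= #|~: rich g k RA RB|%:R :> R.
    rewrite ler_nat subset_leq_card //; apply/subsetP => v vRA.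
    by rewrite in_setC none.
  have k0' : 0 < k%:R :> R by rewrite ltr0n.
  have := ler_wpM2r (ltW k0') g1.
  rewrite cRA; move: poor_k k0'; clear; lra.
have aA : a \in A by apply: subsetP aRA.
have [|f [_ _ _ injf adjf sidef _ _ _]] := full (fun=> a) [set r].
  split=> //.
  - exact: set11.
  - by move=> w /set1P->; rewrite parr set11.
  - by move=> w /set1P->; rewrite rW.
  - by move=> w1 w2 /set1P-> /set1P->.
  - by move=> w /set1P->; rewrite eqxx.
  - by move=> w /set1P->; rewrite aA rP.
  - by move=> w /set1P->; rewrite in_setU aRA /is_top eqxx.
  - rewrite imset_set1 /=.
    have -> : [set a] :&: (A :\: RA) = set0.
      by apply/setP => v; rewrite !inE; case: eqP => // ->; rewrite aRA.
    have -> : [set a] :&: (B :\: RB) = set0.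
      apply/setP => v; rewrite !inE; case: eqP => //= ->; apply/negP => /andP[_ aB].
      by have : a \in A :&: B; [rewrite inE aA|rewrite AB0 inE].
    have e0 Q : energy R Q (set0 : {set G}) <= 0.
      by apply: le_trans (energy_le _ _ _) _; rewrite cards0 expr0n mulr0.
    rewrite cards0 addr0 mulr0.
    by have := e0 (A :\: RA); have := e0 (B :\: RB); clear; lra.
exists f; split=> [w1 w2|w|]; [|exact: adjf|by rewrite sidef].
exact: injf.
Qed.

(** * Choice of constants and conclusion *)

Lemma min_degree_le (G : sgraph) (v : G) : (min_degree G <= degree v)%N.
Proof.
rewrite /min_degree; have := mem_index_enum v.
elim: (index_enum _) => // u s IHs; rewrite inE big_cons geq_min.
by case/predU1P => [->|/IHs->]; rewrite ?leqnn ?orbT.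
Qed.

(** Apart from the root, tops are children of seeds. This is where the degree bound on the tree
    enters. *)
Lemma card_tops (T : sgraph) (r : T) (par : T -> T) (W : {set T}) :
  (forall w, w != r -> adj w (par w)) ->
  (#|[set w | is_top r par W w]| <= 1 + #|W| * max_degree T)%N.
Proof.
move=> adj_par; pose S := [set w | (w != r) && (par w \in W)].
have -> : [set w | is_top r par W w] = r |: S.
  by apply/setP => w; rewrite !inE /is_top; case: eqP.
rewrite cardsU1; apply: leq_add; first by case: (_ \notin _).
apply: (@leq_trans (\sum_(w in S) #|nbh w :&: W|)).
  rewrite -sum1_card; apply: leq_sum => w; rewrite inE => /andP[wr pW].
  by apply/card_gt0P; exists (par w); rewrite !inE adj_par.
rewrite sum_card_nbh -sum_nat_const; apply: leq_sum => x _.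
apply: leq_trans (leq_bigmax x); exact: subset_leq_card (subsetIl _ _).
Qed.

Lemma truncn_ge_half (R : archiRealFieldType) (x : R) : 2 <= x ->
  x / 2 <= (Num.truncn x)%:R <= x.
Proof.
move=> x2; have x0 : 0 <= x by lra.
have /andP[h1 h2] := truncn_itv x0; rewrite h1 andbT.
by move: h2; rewrite -natr1; lra.
Qed.

Lemma archi_bound_le (R : archiRealFieldType) (x : R) :
  exists n : nat, (0 < n)%N /\ forall k : nat, (n <= k)%N -> x <= k%:R.
Proof.
exists (Num.truncn x).+1; split=> // k hk.
by apply: ltW; apply: lt_le_trans (truncnS_gt x) _; rewrite ler_nat.
Qed.

Lemma le1_mul_of_inv_le (R : realFieldType) (a x : R) : 0 < a -> a^-1 <= x -> 1 <= a * x.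
Proof. by move=> a0; rewrite -[in X in X -> _](ler_pM2l a0) mulfV ?gt_eqF. Qed.

Lemma reservoir_size_arith (R : realFieldType) (g sg m k : R) :
  0 < g -> 0 < sg -> 0 < m -> g / 8 * m <= k ->
  1 <= sg * g ^+ 4 / 512 / 128 * m -> 1 <= g ^+ 5 / 64 / 64 * m ->
  16 * m <= (sg * g / 512 * m) * (g ^+ 2 * k) /\ 16 * m <= (g / 4 * k) * (g ^+ 2 * k).
Proof.
move=> g0 sg0 m0 hk m4 m5; have g8 : 0 <= g / 8 * m by rewrite mulr_ge0 ?divr_ge0 // ltW.
split.
  have h0 : 0 <= sg * (g ^+ 3 * m) by rewrite !mulr_ge0 ?exprn_ge0 // ltW.
  by have := ler_wpM2l h0 hk; have := ler_wpM2l (ltW m0) m4; lra.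
have h0 : 0 <= g ^+ 3 by rewrite exprn_ge0 // ltW.
have h2 : (g / 8 * m) * (g / 8 * m) <= k * k by apply: ler_pM.
by have := ler_wpM2l h0 h2; have := ler_wpM2l (ltW m0) m5; lra.
Qed.

(** The premise [g <= 2^-1] stands after the choice of constants because the degree condition on a
    host graph forces it. *)
Lemma almost_spanning_tree_embedding (R : realType) (g : R) : 0 < g ->
  exists (c : R) (n0 : nat), 0 < c /\ (0 < n0)%N /\
    forall n : nat, (n0 <= n)%N -> g <= 2^-1 ->
    forall (G : sgraph) (A B : {set G}),
      balanced_bipartition A B ->
      #|G| = (2 * n)%N ->
      (2^-1 + g) * n%:R <= (min_degree G)%:R ->
    forall (T : sgraph) (r : T),
      tree T ->
      balanced T ->
      #|T| = (2 * Num.truncn ((1 - g) * n%:R))%N ->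
      (max_degree T)%:R <= c * n%:R ->
    exists f : T -> G, embedding f /\ f r \in A.
Proof.
move=> g0.
pose sg := g ^+ 5 / 1024 / 512.
have sg0 : 0 < sg by rewrite /sg !divr_gt0 // exprn_gt0.
(* [xi * m] is the degree guaranteed into [Z] by the host step, hence the admissible component
   size. *)
pose xi := g ^+ 3 * sg ^+ 2 / 128 / 128.
have xi0 : 0 < xi by rewrite /xi !divr_gt0 // mulr_gt0 // exprn_gt0.
(* All seeds but one pay for at least [xi / 2 * m] of the at most [2 * m] tree vertices, so there
   are at most [K] seeds. *)
pose K := 1 + 4 / xi.
have K0 : 0 < K by rewrite addr_gt0 // divr_gt0.
(* With [K] seeds this gives at most [1 + g^2 / 64 * m <= g^2 / 32 * m] tops, which is at most
   [g / 4 * k] as [k >= g / 8 * m]. *)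
pose c := g ^+ 2 / 64 / K.
have c0 : 0 < c by rewrite /c !divr_gt0 // exprn_gt0.
have a2 : 0 < g / 8 by rewrite divr_gt0.
have a3 : 0 < g ^+ 2 / 64 by rewrite divr_gt0 // exprn_gt0.
have a4 : 0 < sg * g ^+ 4 / 512 / 128 by rewrite !divr_gt0 // mulr_gt0 // exprn_gt0.
have a5 : 0 < g ^+ 5 / 64 / 64 by rewrite !divr_gt0 // exprn_gt0.
have [n1 [n1_gt0 hn1]] := archi_bound_le (xi / 2)^-1.
have [n2 [_ hn2]] := archi_bound_le (g / 8)^-1.
have [n3 [_ hn3]] := archi_bound_le (g ^+ 2 / 64)^-1.
have [n4 [_ hn4]] := archi_bound_le (sg * g ^+ 4 / 512 / 128)^-1.
have [n5 [_ hn5]] := archi_bound_le (g ^+ 5 / 64 / 64)^-1.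
have [s [_ hs]] := archi_bound_le (128 / sg ^+ 2).
have s128 : 128 <= s%:R * sg ^+ 2.
  by have := hs s (leqnn s); rewrite ler_pdivrMr // exprn_gt0.
exists c, (n1 + n2 + n3 + n4 + n5)%N; split=> //; split; first by rewrite !addn_gt0 n1_gt0.
move=> n hn g1 G A B [bAB cAB] cG deg T r trT [P0 [Q0 [bPQ cPQ]]] cT maxd.
pose m : R := n%:R.
have m1 : 1 <= xi / 2 * m.
  by apply/le1_mul_of_inv_le/hn1; [rewrite divr_gt0|move: hn; clear; lia].
have m2 : 1 <= g / 8 * m.
  by apply/le1_mul_of_inv_le/hn2; [exact: a2|move: hn; clear; lia].
have m3 : 1 <= g ^+ 2 / 64 * m.
  by apply/le1_mul_of_inv_le/hn3; [exact: a3|move: hn; clear; lia].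
have m4 : 1 <= sg * g ^+ 4 / 512 / 128 * m.
  by apply/le1_mul_of_inv_le/hn4; [exact: a4|move: hn; clear; lia].
have m5 : 1 <= g ^+ 5 / 64 / 64 * m.
  by apply/le1_mul_of_inv_le/hn5; [exact: a5|move: hn; clear; lia].
have m0 : 0 < m by rewrite ltr0n; move: hn n1_gt0; clear; lia.
clear hn1 hn2 hn3 hn4 hn5 hs hn.
have [ABT AB0 _] := bAB.
have cA : #|A| = n.
  by move: cG; rewrite -cardsT -ABT cardsU AB0 cards0 subn0 -cAB; clear; lia.
have cB : #|B| = n by rewrite -cAB.
pose k := Num.truncn (g / 4 * m).
have /truncn_ge_half/andP[klo khi] : 2 <= g / 4 * m by move: m2; clear; lra.
rewrite -/k in klo khi.
have klo' : g / 8 * m <= k%:R by move: klo; clear; lra.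
have k0 : (0 < k)%N.
  by rewrite -(ltr0n R); apply: lt_le_trans klo'; apply: lt_le_trans m2.
have deg' (v : G) : (2^-1 + g) * m <= #|nbh v|%:R.
  by apply: le_trans deg _; rewrite ler_nat; exact: (min_degree_le v).
have [k1 k2] := reservoir_size_arith g0 sg0 m0 klo' m4 m5.
have [RA [RB res]] := @reservoirs_exist R G g sg m k A B bAB (congr1 _ cA) (congr1 _ cB)
  deg' g0 g1 m0 k0 khi k1 k2.
pose s0 := Num.truncn (xi * m).
have /truncn_ge_half/andP[slo shi] : 2 <= xi * m by move: m1; clear; lra.
rewrite -/s0 in slo shi.
have s0_gt0 : (0 < s0)%N.
  rewrite -(ltr0n R); apply: lt_le_trans slo; move: m1; clear; lra.
have [par [dep [parr par_adj adj_par]]] := tree_parent r trT.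
have dep_par v : v != r -> (dep (par v) < dep v)%N by case/par_adj/andP.
have [W [_ rW cW fibW]] := seeds_exist_in parr dep_par s0_gt0 (in_setT r)
  (fun x _ => in_setT (par x)).
(* The root has to land in [A], so [P] is the class of the tree containing it. *)
pose P := if r \in P0 then P0 else Q0.
have [PQT PQ0 _] := bPQ.
have Q0E : Q0 = ~: P0.
  apply/setP => v; rewrite in_setC.
  have : v \in P0 :|: Q0 by rewrite PQT.
  have : v \in P0 :&: Q0 = false by rewrite PQ0 inE.
  by rewrite inE in_setU; case: (v \in P0); case: (v \in Q0).
have cP0 : #|P0| = Num.truncn ((1 - g) * m).
  by move: cT; rewrite -cardsT -PQT cardsU PQ0 cards0 subn0 -cPQ -/m; move: (Num.truncn _); clear; lia.
have hg1 : 0 <= (1 - g) * m by rewrite mulr_ge0 ?(ltW m0) //; move: g1; clear; lra.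
have cP : #|P|%:R <= (1 - g) * m.
  rewrite /P (fun_if (fun X : {set T} => #|X|)) -cPQ if_same cP0.
  by rewrite truncn_le.
have cP' : #|~: P|%:R <= (1 - g) * m.
  have -> : ~: P = if r \in P0 then Q0 else P0.
    by rewrite /P Q0E; case: ifP; rewrite ?setCK.
  rewrite (fun_if (fun X : {set T} => #|X|)) -cPQ if_same cP0.
  by rewrite truncn_le.
have sideP w : w != r -> (par w \in P) = (w \notin P).
  case/par_adj/andP => wp _; rewrite adj_sym in wp; rewrite /P.
  have := bipartition_adj bPQ wp; rewrite Q0E.
  by case: ifP => _; rewrite !in_setC => ->; rewrite ?negbK.
have rP : r \in P by rewrite /P Q0E; case: ifP => // rP0; rewrite in_setC rP0.
have ctop : #|[set w | is_top r par W w]|%:R <= g / 4 * k%:R.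
  have h := @card_tops T r par W (fun w wr => proj1 (andP (par_adj w wr))).
  have WK : #|W|%:R <= K.
    have s0' : 0 < s0%:R :> R by rewrite ltr0n.
    have h1 : #|W|.-1%:R * s0%:R <= 2 * m :> R.
      apply: (@le_trans _ _ #|T|%:R); first by rewrite -natrM ler_nat -cardsT.
      rewrite cT natrM ler_wpM2l //; apply: le_trans (_ : (1 - g) * m <= _).
        by rewrite truncn_le.
      by rewrite -[leRHS]mul1r ler_wpM2r ?(ltW m0) //; move: g0; clear; lra.
    have h2 : #|W|.-1%:R <= 4 / xi.
      rewrite ler_pdivlMr //; rewrite -(ler_pM2r m0).
      have := ler_wpM2l (ler0n R #|W|.-1) slo; move: h1; clear; lra.
    have W0 : (0 < #|W|)%N by apply/card_gt0P; exists r.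
    by rewrite -(prednK W0) -natr1 /K addrC lerD2l.
  have h1 : #|W|%:R * (max_degree T)%:R <= g ^+ 2 / 64 * m.
    have -> : g ^+ 2 / 64 * m = K * (c * m).
      by rewrite /c mulrA [K * _]mulrC divfK // gt_eqF.
    exact: ler_pM.
  apply: (@le_trans _ _ (1 + g ^+ 2 / 64 * m)).
    by rewrite -(ler_nat R) natrD natrM in h; apply: le_trans h _; rewrite lerD2l.
  have h0 : 0 <= g / 4 by rewrite divr_ge0 // ltW.
  have := ler_wpM2l h0 klo'; move: m3; clear; lra.
have ccomp y : #|[set w | top r par dep W w == y]|%:R <= g ^+ 3 * sg ^+ 2 / 128 / 128 * m.
  apply: le_trans shi; rewrite ler_nat; apply: leq_trans (fibW y).
  by apply: subset_leq_card; apply/subsetP => w; rewrite !inE.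
have [f [injf adjf fr]] := embedding_exists res g0 g1 (erefl _) m0 s128 parr dep_par
  sideP cP cP' ctop ccomp rW rP.
exists f; split=> //; split=> // x y /adj_par[[xr <-]|[yr <-]]; first exact: adjf.
by rewrite adj_sym; apply: adjf.
Qed.

Theorem theorem11 (R : realType) (gamma : R) (gamma_gt0 : 0 < gamma) :
  exists (c : R) (n0 : nat), 0 < c /\ (0 < n0)%N /\
    forall n : nat, (n0 <= n)%N ->
    forall (G : sgraph) (A B : {set G}),
      balanced_bipartition A B ->
      #|G| = (2 * n)%N ->
      (2^-1 + gamma) * n%:R <= (min_degree G)%:R ->
    forall (T : sgraph) (r : T),
      tree T ->
      balanced T ->
      #|T| = (2 * Num.truncn ((1 - gamma) * n%:R))%N ->
      (max_degree T)%:R <= c * n%:R ->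
    exists f : T -> G, embedding f /\ f r \in A.
Proof.
have [c [n0 [c0 [n00 H]]]] := almost_spanning_tree_embedding gamma_gt0.
exists c, n0; split=> //; split=> // n hn G A B bAB cG deg.
(* A vertex of [B] has at most [#|A| = n] neighbours, so the degree condition gives
   [2^-1 + gamma <= 1]. *)
suff g1 : gamma <= 2^-1 by apply: H bAB cG deg.
have n_gt0 : (0 < n)%N by apply: leq_trans n00 hn.
have m0 : 0 < n%:R :> R by rewrite ltr0n.
case: bAB => bAB cAB; have [ABT AB0 _] := bAB.
have cA : #|A| = n.
  by move: cG; rewrite -cardsT -ABT cardsU AB0 cards0 subn0 -cAB; clear; lia.
have /card_gt0P[v vB] : (0 < #|B|)%N by rewrite -cAB cA.
have : (min_degree G <= n)%N.
  apply: leq_trans (min_degree_le v) _; rewrite -cA.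
  exact: subset_leq_card (nbh_bip bAB vB).
rewrite -(ler_nat R) => /(le_trans deg).
by rewrite -[leRHS]mul1r ler_pM2r //; lra.
Qed.
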